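(* For $i\in\{1,2\}$ and all $\vartheta>0$, and for $i=3$ and all $\vartheta\ge1$, $$\frac{X^{(i)}_{n,\vartheta n}-\mu_i(\vartheta)n}{\sigma_i(\vartheta)\sqrt n}\longrightarrow\mathcal{N}(0,1)\quad\text{in distribution as }n\to\infty.$$
   Context: $\genfrac{[}{]}{0pt}{}{n}{k}$ and $\genfrac{\{}{\}}{0pt}{}{n}{k}$ are the (unsigned) Stirling numbers of the first and second kind; $S_n(x)=\sum_{k=1}^n\genfrac{[}{]}{0pt}{}{n}{k}x^k=x(x+1)\cdots(x+n-1)$; $T_n(x)=\sum_{k=1}^n\genfrac{\{}{\}}{0pt}{}{n}{k}x^k$. The random variables $X^{(i)}_{n,\theta}$ take values $k\in\{1,\dots,n\}$ with probabilities $\mathbb{P}[X^{(1)}_{n,\theta}=k]=\genfrac{[}{]}{0pt}{}{n}{k}\theta^k/S_n(\theta)$ ($\theta>0$), $\mathbb{P}[X^{(2)}_{n,\theta}=k]=\genfrac{\{}{\}}{0pt}{}{n}{k}\theta^k/T_n(\theta)$ ($\theta>0$), $\mathbb{P}[X^{(3)}_{n,\theta}=k]=\genfrac{\{}{\}}{0pt}{}{n}{k}\theta(\theta-1)\cdots(\theta-k+1)/\theta^n$ ($\theta\in\mathbb{N}$ or real $\theta>n-1$). $W_0:(-1/e,\infty)\to(-1,\infty)$ is the inverse of $w\mapsto we^w$ (principal Lambert branch). For $\vartheta>0$: $$\mu_1(\vartheta)=\vartheta\log(1+1/\vartheta),\quad \sigma_1^2(\vartheta)=\vartheta\log(1+1/\vartheta)-\frac{\vartheta}{1+\vartheta},$$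 $$\mu_2(\vartheta)=\frac{1}{W_0(1/\vartheta)}-\vartheta,\quad \sigma_2^2(\vartheta)=\frac{1}{W_0(1/\vartheta)(1+W_0(1/\vartheta))}-\vartheta,$$ $$\mu_3(\vartheta)=\vartheta(1-e^{-1/\vartheta}),\quad \sigma_3^2(\vartheta)=\vartheta e^{-1/\vartheta}\left(1-e^{-1/\vartheta}-\tfrac1\vartheta e^{-1/\vartheta}\right),$$ and $\sigma_i(\vartheta)>0$ is the square root of $\sigma_i^2(\vartheta)>0$. *)

(* Defs.v *)
From HB Require Import structures.
From mathcomp Require Import all_boot all_order all_algebra perm.
From mathcomp Require Import all_classical all_reals all_analysis.
From mathcomp Require Import measurable_realfun.

Set Implicit Arguments.
Unset Strict Implicit.
Unset Printing Implicit Defensive.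

Import Order.TTheory GRing.Theory Num.Theory.
Import numFieldNormedType.Exports.

Definition stirling1 (n k : nat) : nat :=
  #|[pred s : {perm 'I_n} | #|porbits s| == k]|.

Definition stirling2 (n k : nat) : nat :=
  #|[pred Q : {set {set 'I_n}} | finset.partition Q [set: 'I_n]%SET && (#|Q| == k)]|.

Local Open Scope classical_set_scope.
Local Open Scope ring_scope.

Section Laws.
Context {R : realType}.
Implicit Types (n k : nat) (theta vartheta x : R).

Definition stirling1_poly n x : R :=
  \sum_(1 <= k < n.+1) (stirling1 n k)%:R * x ^+ k.

Definition stirling2_poly n x : R :=
  \sum_(1 <= k < n.+1) (stirling2 n k)%:R * x ^+ k.

Definition ffactr x k : R := \prod_(j < k) (x - j%:R).

Definition pmf1 n theta k : R :=
  (stirling1 n k)%:R * theta ^+ k / stirling1_poly n theta.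

Definition pmf2 n theta k : R :=
  (stirling2 n k)%:R * theta ^+ k / stirling2_poly n theta.

Definition pmf3 n theta k : R :=
  (stirling2 n k)%:R * ffactr theta k / theta ^+ n.

(* Meaningful for x > -1/e, where the set below is a singleton. *)
Definition lambertW0 x : R := xget 0 [set w | -1 < w /\ w * expR w = x].

Definition mu1 vartheta : R := vartheta * ln (1 + vartheta^-1).

Definition var1 vartheta : R :=
  vartheta * ln (1 + vartheta^-1) - vartheta / (1 + vartheta).

Definition mu2 vartheta : R := (lambertW0 vartheta^-1)^-1 - vartheta.

Definition var2 vartheta : R :=
  (lambertW0 vartheta^-1 * (1 + lambertW0 vartheta^-1))^-1 - vartheta.

Definition mu3 vartheta : R := vartheta * (1 - expR (- vartheta^-1)).

Definition var3 vartheta : R :=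
  vartheta * expR (- vartheta^-1) *
    (1 - expR (- vartheta^-1) - vartheta^-1 * expR (- vartheta^-1)).

Definition sigma1 vartheta : R := Num.sqrt (var1 vartheta).
Definition sigma2 vartheta : R := Num.sqrt (var2 vartheta).
Definition sigma3 vartheta : R := Num.sqrt (var3 vartheta).

End Laws.

(* [p] is to be a probability mass function on {1, ..., n}; [X] is then almost
   surely, but not necessarily surely, in this set. *)
Definition has_pmf_on (R : realType) (d : measure_display)
    (T : measurableType d) (P : probability T R) (X : {RV P >-> R})
    (n : nat) (p : nat -> R) : Prop :=
  forall k : nat, (1 <= k <= n)%N -> pmf X k%:R = p k.

Definition standardize (R : realType) (d : measure_display)
    (T : measurableType d) (P : probability T R) (X : {RV P >-> R})
    (m s : R) : {RV P >-> R} :=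
  (X \- cst m) \* cst s^-1.

(* The variables may live on different probability spaces; the limit is given
   by its law. *)
Definition cvg_in_distribution (R : realType) (d : nat -> measure_display)
    (T : forall n, measurableType (d n)) (P : forall n, probability (T n) R)
    (Y : forall n, {RV (P n) >-> R})
    (nu : probability (measurableTypeR R) R) : Prop :=
  forall x : R,
    {for x, continuous (fun y : R => nu `]-oo, y]%classic)} ->
    cdf (Y n) x @[n --> \oo] --> nu `]-oo, x]%classic.

(* Main.v *)
(* The proof is a local limit theorem that only uses ratios of consecutive
   probabilities.

   Let [p_n] be one of the three laws. It is log-concave, so that it is enough to
   know [log (p_n(k) / p_n(k + 1))] up to [o(1 / sqrt n)] for
   [k = mu n + t sigma sqrt n]: if this is [t / (sigma sqrt n)], then summation gives
   [p_n(k) / p_n(mu n) -> exp (- t^2 / 2)], log-concavity gives an exponential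
   bound, and dominated convergence for the associated step functions turns this
   into convergence of distribution functions. The normalization is never computed.

   The ratios are controlled by exact inequalities. With
   [x = [n, k] / [n, k + 1]] (first kind),
     k <= \sum_(i < n) x / (x + i) <= k + 1,
   which follows from log-concavity of the coefficients of [\prod_i (X + i)]
   deprived of one factor. With [x = {n, k} / {n, k + 1}] (second kind) and
   [K = k + 1],
     (x + K) \sum_(1 <= i < K) 1 / (x + i) <= n,
     n + 1 <= (x + K) \sum_(0 <= i < K) 1 / (x + i),
   which follows from Euler's relation for the generating function
   [\prod_(1 <= j <= K) 1 / (1 - j z)] of [{n, K}]. Replacing the sums by logarithms,
   [x / n] is asymptotically the solution [xi] of [xi log (1 + 1 / xi) = k / n],
   respectively of [(xi + kappa) log (1 + kappa / xi) = 1] with [kappa = k / n]. *)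
Require Import Defs.
From HB Require Import structures.
From mathcomp Require Import all_boot all_order all_algebra fingroup perm.
From mathcomp Require Import ring lra zify.
Set Implicit Arguments.
Unset Strict Implicit.
Unset Printing Implicit Defensive.
Import Order.TTheory GRing.Theory Num.Theory.

(** * Recurrences for the Stirling numbers *)

Section CyclesRecurrence.
Import GroupScope.
Variable n : nat.
Implicit Types (s : 'S_n) (i : 'I_n.+1).

Let lift00 s : 'S_n.+1 := lift_perm ord0 ord0 s.

Lemma lift_perm00X s k x : (lift00 s ^+ k) (lift ord0 x) = lift ord0 ((s ^+ k) x).
Proof.
elim: k => [|k IHk]; first by rewrite !expg0 !perm1.
by rewrite !expgSr !permM IHk /lift00 lift_perm_lift.
Qed.

Lemma porbit_lift_perm00_0 s : porbit (lift00 s) ord0 = [set ord0].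
Proof.
apply/setP => x; rewrite inE; apply/porbitP/eqP => [[k ->]|->]; last first.
  by exists 0; rewrite expg0 perm1.
by elim: k => [|k IHk]; rewrite ?expg0 ?perm1// expgSr permM IHk lift_perm_id.
Qed.

Lemma porbit_lift_perm00 s x :
  porbit (lift00 s) (lift ord0 x) = lift ord0 @: porbit s x.
Proof.
apply/setP => y; apply/porbitP/imsetP => [[k ->]|[z /porbitP[k ->] ->]].
  by exists ((s ^+ k) x); [exact: mem_porbit|exact: lift_perm00X].
by exists k; rewrite lift_perm00X.
Qed.

Lemma card_porbits_lift_perm00 s : #|porbits (lift00 s)| = #|porbits s|.+1.
Proof.
have inj_lift : injective (fun A : {set 'I_n} => lift (ord0 : 'I_n.+1) @: A).
  exact: imset_inj (@lift_inj _ _).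
suff -> : porbits (lift00 s) =
    [set ord0] |: ((fun A : {set 'I_n} => lift ord0 @: A) @: porbits s).
  rewrite cardsU1 card_imset//; case: imsetP => [[A _ A0]|]//.
  have : ord0 \in [set (ord0 : 'I_n.+1)] by rewrite inE.
  by rewrite A0 => /imsetP[z _ /eqP]; rewrite (negbTE (neq_lift _ _)).
apply/setP => A; rewrite !inE; apply/imsetP/orP => [[x _ ->]|].
  case: (unliftP ord0 x) => [y|] ->; last by left; rewrite porbit_lift_perm00_0.
  by right; rewrite porbit_lift_perm00 imset_f// imset_f.
case=> [/eqP->|/imsetP[B /imsetP[x _ ->] ->]].
  by exists ord0; rewrite // porbit_lift_perm00_0.
by exists (lift ord0 x); rewrite // porbit_lift_perm00.
Qed.

(** Composing with the transposition inserts [ord0] right after [c.1] into the cycle of [c.1]; for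
    [c.1 = ord0] it stays a fixed point. The point [c.1] is recovered as the preimage of [ord0]. *)
Let insert0 (c : 'I_n.+1 * 'S_n) : 'S_n.+1 := tperm ord0 c.1 * lift00 c.2.

Lemma insert0_bij : bijective insert0.
Proof.
apply: inj_card_bij; last by rewrite card_prod !card_Sn card_ord factS.
move=> [i s] [j t] /= eq_ij; rewrite /insert0 /= in eq_ij.
have ij : i = j.
  apply: (@perm_inj _ (tperm ord0 i * lift00 s)); rewrite [in RHS]eq_ij.
  by rewrite !permM !tpermR /lift00 !lift_perm_id.
congr (_, _) => //; move: eq_ij; rewrite ij => /mulgI eq_st.
apply/permP => x; apply: (@lift_inj _ ord0).
by rewrite -!(lift_perm_lift ord0) -!/(lift00 _) eq_st.
Qed.

(** In the lifted permutation [ord0] is alone in its cycle, so a nontrivial transposition merges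
    this cycle with another one. *)
Lemma card_porbits_insert0 i s :
  #|porbits (insert0 (i, s))| = ((i == ord0) + #|porbits s|)%N.
Proof.
have := porbits_mul_tperm (lift00 s) ord0 i.
rewrite /insert0 /= card_porbits_lift_perm00 porbit_sym porbit_lift_perm00_0 inE.
rewrite [ord0 == i]eq_sym; case: (i == ord0) => /=; first by rewrite double0 !addn0.
by rewrite addn1 -[1.*2]/2 addn2 => -[].
Qed.

Lemma stirling1S k :
  stirling1 n.+1 k = (n * stirling1 n k + (0 < k)%N * stirling1 n k.-1)%N.
Proof.
rewrite /stirling1 -!sum1_card.
rewrite (reindex insert0) /=; last exact: onW_bij insert0_bij.
rewrite big_mkcond -(pair_bigA _ (fun i s =>
  if #|porbits (insert0 (i, s))| == k then 1 else 0)%N) /=.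
under eq_bigr do under eq_bigr do rewrite card_porbits_insert0.
rewrite big_ord_recl /= addnC; congr (_ + _)%N.
  under eq_bigr do under eq_bigr do rewrite add0n.
  by rewrite sum_nat_const card_ord -big_mkcond.
case: k => [|k]; first by rewrite mul0n big1.
by rewrite mul1n -big_mkcond.
Qed.

End CyclesRecurrence.

Lemma stirling1_0 k : stirling1 0 k = (k == 0)%N.
Proof.
have all1 (s : 'S_0) : s = 1%g by apply/permP => -[].
have porbits0 (s : 'S_0) : #|porbits s| = 0%N.
  by apply/eqP; rewrite cards_eq0 -subset0; apply/subsetP => A /imsetP[[]].
rewrite /stirling1 -sum1_card big_mkcond /= (big_pred1 1%g) => [|s].
  by rewrite inE porbits0 eq_sym; case: eqP.
by rewrite [s]all1 /= eqxx.
Qed.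

(** * Set partitions counted by their blocks *)

Section PartitionRecurrence.
Variable T : finType.
Implicit Types (A B C : {set T}) (Q : {set {set T}}) (x : T) (k : nat).

Definition parts A k := [set Q | partition Q A & #|Q| == k].

Lemma partsP Q A k : reflect (partition Q A /\ #|Q| = k) (Q \in parts A k).
Proof. by rewrite inE; apply: (iffP andP) => -[? /eqP]. Qed.

Lemma parts_addset1 x B k : x \notin B ->
  #|[set Q in parts (x |: B) k.+1 | [set x] \in Q]| = #|parts B k|.
Proof.
move=> xB; have notin Q : Q \in parts B k -> [set x] \notin Q.
  move=> /partsP[PQ _]; apply: contra xB => /(partitionS PQ).
  by rewrite sub1set.
rewrite -(@card_in_imset _ _ (fun Q => [set x] |: Q) (mem (parts B k))); last first.
  by move=> Q Q' /notin QP /notin Q'P eqQ; rewrite -(setU1K QP) eqQ setU1K.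
apply: eq_card => Q; rewrite !inE; apply/andP/imsetP => [[/andP[PQ /eqP cQ] xQ]|].
  exists (Q :\ [set x]); last by rewrite setD1K.
  apply/partsP; split; last by move: cQ; rewrite (cardsD1 [set x]) xQ => -[].
  by have := partitionD1 PQ xQ; rewrite setU1K.
case=> Q' /[dup] /notin nQ' /partsP[PQ' cQ'] ->; split; last exact: setU11.
rewrite cardsU1 nQ' cQ' eqxx andbT; apply: partitionU1 => //.
  by apply/set0Pn; exists x; rewrite inE.
by rewrite disjoints1.
Qed.

(* [x] is put into the block [C] of [Q]. *)
Let put x (QC : {set {set T}} * {set T}) := (x |: QC.2) |: (QC.1 :\ QC.2).

(** [put x] is a bijection from [D], the partitions of [B] with a marked block. The inverse removes
    [x] from its block and marks what remains, which is nonempty because [[set x]] is not a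
    block. *)
Lemma parts_addblock x B k : x \notin B ->
  #|[set Q in parts (x |: B) k | [set x] \notin Q]| = (k * #|parts B k|)%N.
Proof.
move=> xB; pose D := [set QC : {set {set T}} * {set T} |
  (QC.1 \in parts B k) && (QC.2 \in QC.1)].
have cD : #|D| = (k * #|parts B k|)%N.
  rewrite -sum1_card (eq_bigl (fun QC : {set {set T}} * {set T} =>
    (QC.1 \in parts B k) && (QC.2 \in QC.1))) => [|QC]; last by rewrite inE.
  rewrite -(pair_big_dep (fun Q => Q \in parts B k) (fun Q C => C \in Q)
     (fun _ _ => 1%N)) /=.
  rewrite (eq_bigr (fun=> k)) ?sum_nat_const 1?mulnC// => Q /partsP[_ <-].
  by rewrite sum1_card.
have notin Q C : partition Q B -> C \in Q -> x \notin C.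
  by move=> PQ CQ; apply: contra xB; exact/subsetP/(partitionS PQ CQ).
have notinQ Q C : partition Q B -> (x |: C) \in Q = false.
  move=> PQ; apply/negP => CQ; have := notin _ _ PQ CQ.
  by rewrite setU11.
rewrite -cD -(@card_in_imset _ _ (put x) (mem D)); last first.
  move=> [Q C] [Q' C']; rewrite !inE /= => /andP[/andP[PQ _] CQ].
  move=> /andP[/andP[PQ' _] CQ']; rewrite /put /= => eqQ.
  (* The enlarged block is the only one containing [x]. *)
  have eqU : x |: C = x |: C'.
    have : x |: C \in (x |: C') |: (Q' :\ C') by rewrite -eqQ setU11.
    by rewrite !inE notinQ// andbF orbF => /eqP.
  have eqC : C = C'.
    by rewrite -(setU1K (notin _ _ PQ CQ)) eqU (setU1K (notin _ _ PQ' CQ')).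
  move: eqQ; rewrite -eqC => eqQ.
  have eqD : Q :\ C = Q' :\ C.
    rewrite -(@setU1K _ (x |: C) (Q :\ C)) ?inE ?notinQ ?andbF//.
    by rewrite eqQ setU1K// !inE notinQ ?andbF.
  by rewrite -(setD1K CQ) eqD setD1K// eqC.
apply: eq_card => Q; rewrite !inE; apply/andP/imsetP => [[/andP[PQ /eqP cQ] xQ]|].
  have xC : x \in cover Q by rewrite (cover_partition PQ) setU11.
  set C := pblock Q x; have CQ : C \in Q by rewrite pblock_mem.
  have xinC : x \in C by rewrite mem_pblock.
  have C0 : C :\ x != set0.
    apply: contraNneq xQ => C0; rewrite -(_ : C = [set x])//.
    by rewrite -(setD1K xinC) C0 setU0.
  have disj C' : C' \in Q -> C' != C -> [disjoint C & C'].
    move=> C'Q neC; have /trivIsetP tQ := partition_trivIset PQ.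
    by rewrite disjoint_sym; exact: tQ.
  have CxQ : (C :\ x) \notin Q.
    apply/negP => CxQ; have := disj _ CxQ.
    have -> : C :\ x != C by apply/eqP => /setP/(_ x); rewrite !inE eqxx xinC.
    move=> /(_ isT)/pred0P dis; case/set0Pn: C0 => y yC.
    by have := dis y; rewrite /= yC; move: yC; rewrite inE => /andP[_ ->].
  exists ((C :\ x) |: (Q :\ C), C :\ x); last first.
    rewrite /put /= setD1K// setU1K ?setD1K//.
    by rewrite !inE (negbTE CxQ) andbF.
  rewrite inE /= setU11 andbT; apply/partsP; split; last first.
    rewrite cardsU1 !inE (negbTE CxQ) andbF -cQ (cardsD1 C Q) CQ.
    by [].
  have -> : B = (C :\ x) :|: (x |: B) :\: C.
    apply/setP => y; rewrite !inE; case: (eqVneq y x) => [->|yx] /=.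
      by rewrite xinC (negbTE xB).
    have [yC|//] /= := boolP (y \in C); have := subsetP (partitionS PQ CQ) y yC.
    by rewrite !inE (negbTE yx).
  apply: partitionU1 => //; first exact: partitionD1.
  rewrite -setI_eq0; apply/eqP/setP => y; rewrite !inE.
  by case: (y \in C); rewrite ?andbF.
case=> -[Q' C]; rewrite inE /= => /andP[/partsP[PQ' cQ'] CQ'] ->; rewrite /put /=.
have xC := notin _ _ PQ' CQ'; split; last first.
  rewrite !inE negb_or negb_and; apply/andP; split; last first.
    by apply/orP; right; rewrite -[[set x]]setU0 notinQ.
  apply: contraTneq (partition_neq0 PQ' CQ') => eqx; rewrite negbK.
  by rewrite -(setU1K xC) -eqx setDv.
rewrite cardsU1 !inE notinQ// andbF -cQ' (cardsD1 C Q') CQ' eqxx andbT.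
have -> : x |: B = (x |: C) :|: (B :\: C).
  rewrite -setUA; congr (_ :|: _); apply/setP => y; rewrite !inE.
  by have [/(subsetP (partitionS PQ' CQ')) ->|] := boolP (y \in C).
apply: partitionU1; first exact: partitionD1.
  by apply/set0Pn; exists x; rewrite setU11.
rewrite -setI_eq0; apply/eqP/setP => y; rewrite !inE.
case: (eqVneq y x) => [->|]/=; first by rewrite (negbTE xB) andbF.
by case: (y \in C); rewrite ?andbF.
Qed.

Lemma card_partsU1 x B k : x \notin B ->
  #|parts (x |: B) k| = (k * #|parts B k| + (0 < k)%N * #|parts B k.-1|)%N.
Proof.
move=> xB; rewrite -(cardsID [set Q : {set {set T}} | [set x] \in Q]) addnC; congr (_ + _)%N.
  by rewrite -(parts_addblock _ xB); apply: eq_card => Q; rewrite !inE andbC.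
case: k => [|k]; last first.
  by rewrite mul1n -(parts_addset1 _ xB); apply: eq_card => Q; rewrite !inE.
rewrite mul0n; apply/eqP; rewrite cards_eq0 -subset0; apply/subsetP => Q.
by rewrite !inE cards_eq0 => /andP[/andP[_ /eqP->]]; rewrite inE.
Qed.

End PartitionRecurrence.

Lemma card_parts_imset (T T' : finType) (f : T -> T') (A : {set T}) k :
  injective f -> #|parts (f @: A) k| = #|parts A k|.
Proof.
move=> f_inj; have F_inj := imset_inj f_inj.
rewrite -(card_imset _ (imset_inj F_inj)); apply: eq_card => Q.
rewrite inE; apply/andP/imsetP => [[PQ /eqP cQ]|[Q' /partsP[PQ' cQ'] ->]].
  have QE : Q = (fun B : {set T} => f @: B) @: [set B : {set T} | f @: B \in Q].
    apply/setP => B; apply/idP/imsetP => [BQ|[C]]; last by rewrite inE => ? ->.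
    have BE : B = f @: (f @^-1: B).
      apply/setP => y; apply/idP/imsetP => [yB|[z]]; last by rewrite inE => ? ->.
      have /imsetP[z _ yz] := subsetP (partitionS PQ BQ) y yB.
      by exists z; rewrite // inE -yz.
    by exists (f @^-1: B); rewrite // inE -BE.
  exists [set B : {set T} | f @: B \in Q] => //; apply/partsP; split.
    by move: PQ; rewrite {1}QE imset_partition.
  by rewrite -cQ [in RHS]QE card_imset.
by rewrite imset_partition// card_imset// cQ'.
Qed.

Lemma stirling2S n k :
  stirling2 n.+1 k = (k * stirling2 n k + (0 < k)%N * stirling2 n k.-1)%N.
Proof.
have E m j : stirling2 m j = #|parts [set: 'I_m] j|.
  by rewrite /stirling2; apply: eq_card => Q; rewrite !inE.
rewrite !E; have -> : [set: 'I_n.+1] = ord0 |: (lift ord0 @: [set: 'I_n]).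
  apply/setP => x; rewrite !inE; case: (unliftP ord0 x) => [y ->|->//].
  by rewrite imset_f ?inE// orbT.
rewrite card_partsU1 ?card_parts_imset//; try exact: lift_inj.
by apply/imsetP => -[y _ /eqP]; rewrite (negbTE (neq_lift _ _)).
Qed.

Lemma stirling2_0 k : stirling2 0 k = (k == 0)%N.
Proof.
have -> : stirling2 0 k = #|[set Q : {set {set 'I_0}} | (Q == set0) && (k == 0)%N]|.
  rewrite /stirling2; apply: eq_card => Q; rewrite !inE.
  have -> : [set: 'I_0] = set0 by apply/setP => -[].
  rewrite partition_set0; case: eqP => //= ->; by rewrite cards0 eq_sym.
case: eqP => _ /=.
  rewrite -(cards1 (set0 : {set {set 'I_0}})); apply: eq_card => Q.
  by rewrite !inE andbT.
by apply/eqP; rewrite cards_eq0; apply/eqP/setP => Q; rewrite !inE andbF.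
Qed.

Local Open Scope ring_scope.

(** * Log-concavity and bounds for consecutive ratios *)

Section LogConcave.
Variable R : realFieldType.
Implicit Types a w : nat -> R.

(* The total positivity form of log-concavity: unlike [a i * a i.+2 <= a i.+1 ^+ 2]
   it excludes internal zeros. *)
Definition logconcave a :=
  forall i j, (i <= j)%N -> a i * a j.+1 <= a i.+1 * a j.

(** This covers both kinds: [v = 0] is multiplication of a polynomial by ['X + u], while [u = 0] and
    [v = 1] is the recurrence [stirling2S]. *)
Lemma logconcave_recurrence a (u v : R) : 0 <= u -> 0 <= v ->
  (forall i, 0 <= a i) -> logconcave a ->
  logconcave (fun i => (u + v * i%:R) * a i + (0 < i)%:R * a i.-1).
Proof.
move=> u0 v0 a0 lca i j ij /=.
rewrite ?mulr1n !mul1r; set si := _ * a i.-1; set sj := _ * a j.-1.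
have si0 : 0 <= si by rewrite /si mulr_ge0.
have sj0 : 0 <= sj by rewrite /sj mulr_ge0.
have ss : si * a j <= a i * sj.
  rewrite /si /sj; case: i j ij {si sj si0 sj0} => [|i] [|j]//= ij.
  - by rewrite !mul0r mulr0.
  - by rewrite !mul0r mul1r mulr_ge0.
  - by rewrite !mul1r; exact: lca.
have XY : si * a j.+1 <= a i * a j.
  rewrite /si; case: i ij {si sj si0 sj0 ss} => [|i] ij /=; first by rewrite !mul0r mulr_ge0.
  by rewrite mul1r; apply: lca; exact: ltnW.
have XZ : si * a j.+1 <= a i.+1 * sj.
  have [eij|lij] := eqVneq i j; first by rewrite /si /sj eij mulrC.
  apply: (le_trans XY); rewrite /sj; case: j ij lij {sj sj0 ss XY} => [|j] ij lij.
    by move: ij lij; rewrite leqn0 => ->.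
  by rewrite mul1r; apply: lca; rewrite -ltnS ltn_neqAle lij.
have aa := lca i j ij.
have IJ : 0 <= (i%:R : R) <= j%:R by rewrite ler0n ler_nat.
rewrite -!natr1; set I := i%:R in IJ *; set J := j%:R in IJ *.
have w1 : (u + v * I) * (u + v * (J + 1)) <= (u + v * (I + 1)) * (u + v * J).
  rewrite -subr_ge0 (_ : _ - _ = v ^+ 2 * (J - I)); last by ring.
  by rewrite mulr_ge0 ?sqr_ge0//; lra.
have wi : 0 <= u + v * I by rewrite addr_ge0 ?mulr_ge0//; lra.
have wj : 0 <= u + v * J by rewrite addr_ge0 ?mulr_ge0//; lra.
have wi1 : 0 <= u + v * (I + 1) by rewrite addr_ge0 ?mulr_ge0//; lra.
have wj1 : 0 <= u + v * (J + 1) by rewrite addr_ge0 ?mulr_ge0//; lra.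
have t1 : (u + v * I) * (u + v * (J + 1)) * (a i * a j.+1) <=
    (u + v * (I + 1)) * (u + v * J) * (a i.+1 * a j).
  by apply: ler_pM; rewrite ?mulr_ge0.
have t2 : (u + v * (I + 1)) * (si * a j.+1) <= (u + v * (I + 1)) * (a i.+1 * sj).
  by rewrite ler_wpM2l.
have t3 : v * (J - I) * (si * a j.+1) <= v * (J - I) * (a i * a j).
  by rewrite ler_wpM2l// mulr_ge0//; lra.
(* On each side an excess [v * (J - I)] is split off the weight of a cross term; the expansions can
   then be compared term by term, by [t1], [t2], [t3] and [ss]. *)
have -> : ((u + v * I) * a i + si) * ((u + v * (J + 1)) * a j.+1 + a j) =
  (u + v * I) * (u + v * (J + 1)) * (a i * a j.+1) + (u + v * (I + 1)) * (si * a j.+1)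
  + v * (J - I) * (si * a j.+1) + (u + v * I) * (a i * a j) + si * a j by ring.
have -> : ((u + v * (I + 1)) * a i.+1 + a i) * ((u + v * J) * a j + sj) =
  (u + v * (I + 1)) * (u + v * J) * (a i.+1 * a j) + (u + v * (I + 1)) * (a i.+1 * sj)
  + v * (J - I) * (a i * a j) + (u + v * I) * (a i * a j) + a i * sj by ring.
lra.
Qed.

End LogConcave.

(** * First kind: rising factorials and the mean of the tilted law *)

Section FirstKind.
Variable R : realFieldType.
Implicit Types (n k : nat).

Lemma stirling1_gt_eq0 n k : (n < k)%N -> stirling1 n k = 0%N.
Proof.
elim: n k => [|n IHn] [|k]// nk; first by rewrite stirling1_0.
by rewrite stirling1S !IHn// ?muln0// ltnW.
Qed.

Lemma stirling1_gt0 n k : (0 < k <= n)%N -> (0 < stirling1 n k)%N.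
Proof.
elim: n k => [|n IHn] [|k]//=; rewrite ltnS => kn.
rewrite stirling1S addn_gt0 mul1n /=; case: k kn => [_|k kn]; last first.
  by rewrite IHn ?orbT.
case: n IHn => [|n] IHn; first by rewrite !stirling1_0 orbT.
by rewrite muln_gt0 /= IHn.
Qed.

Lemma stirling1_n0 n : stirling1 n.+1 0 = 0%N.
Proof.
by elim: n => [|n IHn]; rewrite stirling1S mul0n addn0 ?IHn ?muln0.
Qed.

Lemma coef_mulXaddC (p : {poly R}) (c : R) i :
  (('X + c%:P) * p)`_i = c * p`_i + (0 < i)%:R * p`_i.-1.
Proof.
rewrite mulrDl coefD coefXM coefCM addrC; congr (_ + _).
by case: i => [|i] /=; rewrite ?mul0r// mul1r.
Qed.

Lemma coef_prod_stirling1 n k :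
  (\prod_(0 <= i < n) ('X + (i%:R : R)%:P))`_k = (stirling1 n k)%:R.
Proof.
elim: n k => [|n IHn] k; first by rewrite big_nil coef1 stirling1_0.
rewrite big_nat_recr//= mulrC coef_mulXaddC !IHn stirling1S natrD !natrM.
by [].
Qed.

(** The predicate leaves room for products deprived of one factor. *)
Lemma logconcave_prodXaddC (r : seq nat) (P : pred nat) :
  let p := \prod_(i <- r | P i) ('X + (i%:R : R)%:P) in
  (forall k, 0 <= p`_k) /\ logconcave (fun k => p`_k).
Proof.
elim: r => [|x r [IH1 IH2]] /=.
  rewrite big_nil; split => [k|i j ij]; first by rewrite coef1 ler0n.
  by rewrite !coef1 /= mulr0 mul0r.
rewrite big_cons; case: ifP => // Px.
set p := \prod_(j <- r | P j) _ in IH1 IH2 *.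
split=> [k|i j ij]; first by rewrite coef_mulXaddC addr_ge0 ?mulr_ge0.
have := @logconcave_recurrence _ _ x%:R 0 (ler0n _ _) (lexx _) IH1 IH2 i j ij.
by rewrite !mul0r !addr0 !coef_mulXaddC.
Qed.

Lemma deriv_prodXaddC (r : seq nat) : uniq r ->
  (\prod_(i <- r) ('X + (i%:R : R)%:P))^`() =
  \sum_(j <- r) \prod_(i <- r | i != j) ('X + (i%:R : R)%:P).
Proof.
elim: r => [_|x r IHr /= /andP[xr ur]]; first by rewrite !big_nil derivC.
rewrite !big_cons derivM IHr// derivD derivX derivC addr0 mul1r eqxx /=.
congr (_ + _).
  rewrite [RHS]big_seq_cond [LHS]big_seq_cond; apply: eq_bigl => i.
  have [ir|] := boolP (i \in r) => //=.
  by case: eqVneq => // ix; move: xr; rewrite -ix ir.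
rewrite mulr_sumr [RHS]big_seq [LHS]big_seq; apply: eq_bigr => j jr.
rewrite big_cons ifT//; by case: eqVneq => // xj; move: xr; rewrite xj jr.
Qed.

(* Under the weights [stirling1 n i * x ^+ i] with [x = a / b], the values [k]
   and [k.+1] are equally likely and the mean is the sum below; so this says
   that the mode is within distance one of the mean. *)
Lemma stirling1_ratio_mean n k : (0 < k < n)%N ->
  let a : R := (stirling1 n k)%:R in let b : R := (stirling1 n k.+1)%:R in
  k%:R <= \sum_(0 <= j < n) a / (a + j%:R * b) /\
  \sum_(0 <= j < n) a / (a + j%:R * b) <= k.+1%:R.
Proof.
move=> /andP[k0 kn] a b; pose P : {poly R} := \prod_(0 <= i < n) ('X + (i%:R)%:P).
pose Q j : {poly R} := \prod_(0 <= i < n | i != j) ('X + (i%:R)%:P).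
have a0 : 0 < a by rewrite ltr0n stirling1_gt0// k0 ltnW.
have b0 : 0 < b by rewrite ltr0n stirling1_gt0.
have PQ j : (j < n)%N -> P = ('X + (j%:R)%:P) * Q j.
  by move=> jn; rewrite /P (bigD1_seq j) ?mem_index_iota ?iota_uniq.
(* The derivative of [P] is the sum of the [Q j]. *)
have QE i : \sum_(0 <= j < n) (Q j)`_i = (stirling1 n i.+1)%:R *+ i.+1.
  by rewrite -coef_sum -deriv_prodXaddC ?iota_uniq// coef_deriv coef_prod_stirling1.
have step j : (j < n)%N -> [/\ (Q j)`_k.-1 * (Q j)`_k.+1 <= (Q j)`_k * (Q j)`_k,
    a = j%:R * (Q j)`_k + (Q j)`_k.-1 & b = j%:R * (Q j)`_k.+1 + (Q j)`_k].
  move=> jn; have [Q0 Qlc] := logconcave_prodXaddC (index_iota 0 n) (fun i => i != j).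
  split => //; first by have := Qlc k.-1 k; rewrite leq_pred prednK//; exact.
    by rewrite /a -coef_prod_stirling1 -/P (PQ j)// coef_mulXaddC k0 mul1r.
  by rewrite /b -coef_prod_stirling1 -/P (PQ j)// coef_mulXaddC mul1r.
(* Both bounds hold summand by summand: after multiplication by [a], respectively [b], the integer
   side becomes a sum of coefficients of the [Q j], and clearing denominators leaves a nonnegative
   multiple of [q1 * q1 - q0 * q2]. *)
split.
  rewrite -(ler_pM2r a0) mulr_suml.
  have -> : k%:R * a = \sum_(0 <= j < n) (Q j)`_k.-1.
    by rewrite QE prednK// mulr_natl.
  apply: ler_sum_nat => j /andP[_ jn]; have [] := step j jn.
  set q0 := (Q j)`_k.-1; set q1 := (Q j)`_k; set q2 := (Q j)`_k.+1.
  move=> lcq aE bE.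
  have d0 : 0 < a + j%:R * b by rewrite ltr_wpDr ?mulr_ge0// ltW.
  rewrite mulrAC ler_pdivlMr// -subr_ge0.
  rewrite (_ : _ - _ = j%:R ^+ 2 * (q1 * q1 - q0 * q2)); last by rewrite aE bE; ring.
  by rewrite mulr_ge0 ?sqr_ge0// subr_ge0.
rewrite -(ler_pM2r b0) mulr_suml.
have -> : k.+1%:R * b = \sum_(0 <= j < n) (Q j)`_k by rewrite QE mulr_natl.
apply: ler_sum_nat => j /andP[_ jn]; have [] := step j jn.
set q0 := (Q j)`_k.-1; set q1 := (Q j)`_k; set q2 := (Q j)`_k.+1.
move=> lcq aE bE.
have d0 : 0 < a + j%:R * b by rewrite ltr_wpDr ?mulr_ge0// ltW.
rewrite mulrAC ler_pdivrMr// -subr_ge0.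
rewrite (_ : _ - _ = j%:R * (q1 * q1 - q0 * q2)); last by rewrite aE bE; ring.
by rewrite mulr_ge0// subr_ge0.
Qed.

Lemma logconcave_stirling1 n : logconcave (fun k => (stirling1 n k)%:R : R).
Proof.
move=> i j ij; rewrite -!coef_prod_stirling1.
by have [_ /(_ i j ij)] := logconcave_prodXaddC (index_iota 0 n) xpredT.
Qed.

End FirstKind.

(** * Consecutive ratios after multiplication by a geometric series *)

Section GeometricFactor.
Variable R : realFieldType.
Implicit Types (a : nat -> R) (mu nu : R) (n : nat).

(* If [a] has generating function [A(z)], then [geo mu a] has generating
   function [A(z) / (1 - mu z)]. *)
Fixpoint geo mu a n : R :=
  if n is m.+1 then a n + mu * geo mu a m else a 0%N.

Lemma geoS mu a n : geo mu a n.+1 = a n.+1 + mu * geo mu a n.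
Proof. by []. Qed.

Lemma geo_geoS mu nu a n :
  geo mu (geo nu a) n.+1 = geo mu a n.+1 + nu * geo mu (geo nu a) n.
Proof.
elim: n => [|n IHn]; first by rewrite /=; ring.
rewrite [LHS]geoS [in LHS]IHn (geoS nu a n.+1) (geoS mu a n.+1).
by rewrite (geoS mu (geo nu a) n); ring.
Qed.

Variable a : nat -> R.
Hypothesis a_gt0 : forall n, 0 < a n.
Hypothesis a_lc : forall n, a n * a n.+2 <= a n.+1 ^+ 2.

Lemma geo_gt0 mu n : 0 <= mu -> 0 < geo mu a n.
Proof.
by move=> mu0; elim: n => [|n IHn] //=; rewrite ltr_wpDr// mulr_ge0// ltW.
Qed.

(** Log-concavity and the induction hypothesis give the chain [a n.+2 / a n.+1 <= a n.+1 / a n <=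
    geo mu a n.+1 / geo mu a n], which is what the next case needs. *)
Lemma geo_ratio mu n : 0 <= mu -> a n.+1 * geo mu a n <= geo mu a n.+1 * a n.
Proof.
move=> mu0; elim: n => [|n IHn] /=.
  by rewrite mulrDl lerDl -mulrA mulr_ge0// mulr_ge0// ltW.
rewrite -[geo mu a n.+1]/(a n.+1 + mu * geo mu a n) in IHn *.
set E := geo mu a n in IHn *; set E1 := a n.+1 + mu * E in IHn *.
have E0 : 0 < E by exact: geo_gt0.
suff H : a n.+2 * E <= a n.+1 * E1.
  rewrite -subr_ge0 (_ : _ - _ = mu * (a n.+1 * E1 - a n.+2 * E)); last by rewrite /E1; ring.
  by rewrite mulr_ge0// subr_ge0.
rewrite -(ler_pM2r (a_gt0 n)).
have := ler_wpM2r (ltW E0) (a_lc n); have := ler_wpM2l (ltW (a_gt0 n.+1)) IHn.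
rewrite expr2; lra.
Qed.

Lemma geo_lc mu n : 0 <= mu -> geo mu a n * geo mu a n.+2 <= geo mu a n.+1 ^+ 2.
Proof.
move=> mu0; have H := geo_ratio n.+1 mu0.
have -> : geo mu a n.+2 = a n.+2 + mu * geo mu a n.+1 by [].
have H0 := geo_ratio n mu0.
have E0 := geo_gt0 n mu0; have E1 := geo_gt0 n.+1 mu0.
have : geo mu a n * a n.+2 <= geo mu a n.+1 * a n.+1.
  rewrite -(ler_pM2r (a_gt0 n)).
  have := ler_wpM2r (ltW E0) (a_lc n); have := ler_wpM2l (ltW (a_gt0 n.+1)) H0.
  rewrite expr2; lra.
have -> : geo mu a n.+1 = a n.+1 + mu * geo mu a n by [].
rewrite expr2; lra.
Qed.

Lemma geo_ratio_homo mu nu n : 0 <= mu -> mu <= nu ->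
  geo mu a n.+1 * geo nu a n <= geo nu a n.+1 * geo mu a n.
Proof.
move=> mu0 munu; have nu0 := le_trans mu0 munu; elim: n => [|n IHn].
  by rewrite /= ler_wpM2r// ?lerD2l ?ler_wpM2r// ltW.
have E0 := geo_gt0 n mu0; have F0 := geo_gt0 n nu0.
have H := geo_ratio n mu0.
have E1p := geo_gt0 n.+1 mu0; have F1p := geo_gt0 n.+1 nu0.
have := geoS mu a n; have := geoS nu a n.
rewrite (geoS mu a n.+1) (geoS nu a n.+1).
move: IHn H E0 F0 E1p F1p.
move: (geo mu a n) (geo nu a n) (geo mu a n.+1) (geo nu a n.+1) => E F E1 F1.
move=> IHn H E0 F0 E1p F1p F1E E1E.
have [A0 A1 A2] : [/\ 0 < a n, 0 < a n.+1 & 0 < a n.+2] by [].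
pose h := a n.+2 / a n.+1.
have hE : a n.+2 = h * a n.+1 by rewrite mulfVK// gt_eqF.
have h0 : 0 <= h by rewrite divr_ge0// ltW.
have hE1 : h * E <= E1.
  rewrite -(ler_pM2r A0); apply: le_trans H.
  rewrite mulrAC ler_wpM2r ?(ltW E0)// mulrAC ler_pdivrMr// -expr2 mulrC.
  exact: a_lc.
have a1E : a n.+1 = E1 - mu * E by rewrite E1E; ring.
have a1F : a n.+1 = F1 - nu * F by rewrite F1E; ring.
rewrite -subr_ge0 (_ : _ - _ = (nu - mu) * E1 * F1 - a n.+2 * (F1 - E1)); last by ring.
have -> : a n.+2 * (F1 - E1) = h * (E1 - mu * E) * (nu * F) - h * (F1 - nu * F) * (mu * E).
  by rewrite -a1E -a1F hE E1E F1E; ring.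
(* The first summand is nonnegative by [hE1], the second by the induction hypothesis. *)
rewrite (_ : _ - _ = (nu - mu) * (F1 * (E1 - h * E)) + nu * h * (F1 * E - E1 * F)); last by ring.
by rewrite addr_ge0// mulr_ge0 ?subr_ge0// mulr_ge0// ?subr_ge0// ltW.
Qed.

End GeometricFactor.

(** * Second kind: complete homogeneous symmetric polynomials *)

Section SecondKind.
Variable R : realFieldType.
Implicit Types (n k : nat).

Lemma stirling2_gt_eq0 n k : (n < k)%N -> stirling2 n k = 0%N.
Proof.
elim: n k => [|n IHn] [|k]// nk; first by rewrite stirling2_0.
by rewrite stirling2S !IHn// ?muln0// ltnW.
Qed.

Lemma stirling2_gt0 n k : (0 < k <= n)%N -> (0 < stirling2 n k)%N.
Proof.
elim: n k => [|n IHn] [|k]//=; rewrite ltnS => kn.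
rewrite stirling2S addn_gt0 mul1n /=; case: k kn => [_|k kn]; last first.
  by rewrite IHn ?orbT.
case: n IHn => [|n] IHn; first by rewrite !stirling2_0 orbT.
by rewrite muln_gt0 /= IHn.
Qed.

Lemma stirling2_n0 n : stirling2 n.+1 0 = 0%N.
Proof. by rewrite stirling2S !mul0n. Qed.

Lemma logconcave_stirling2 n : logconcave (fun k => (stirling2 n k)%:R : R).
Proof.
elim: n => [|n IHn]; first by move=> i j ij; rewrite !stirling2_0 mulr0 mul0r.
move=> i j ij.
have := @logconcave_recurrence _ _ 0 1 (lexx _) ler01 (fun=> ler0n _ _) IHn i j ij.
have E m : (0 + 1 * m%:R) * (stirling2 n m)%:R + (0 < m)%:R * (stirling2 n m.-1)%:R =
    (stirling2 n.+1 m)%:R :> R by rewrite add0r mul1r stirling2S natrD !natrM.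
by rewrite !E.
Qed.

(* [complete k n] is the complete homogeneous symmetric polynomial of degree [n]
   in the variables [1, ..., k]. *)
Fixpoint complete k : nat -> R :=
  if k is k'.+1 then geo k%:R (complete k') else fun n => (n == 0%N)%:R.

Lemma completeE k n : complete k n = (stirling2 (k + n) k)%:R.
Proof.
elim: k n => [|k IHk] n /=.
  by case: n => [|n]; rewrite ?stirling2_0// add0n stirling2_n0.
elim: n => [|n IHn] /=.
  by rewrite IHk !addn0 stirling2S (@stirling2_gt_eq0 k k.+1)// muln0 mul1n.
rewrite IHn IHk [(k.+1 + n.+1)%N]addSn [in RHS]stirling2S mul1n natrD natrM addrC.
by rewrite addSn addnS.
Qed.

Lemma complete_gt0 k n : (0 < k)%N -> 0 < complete k n.
Proof. by move=> k0; rewrite completeE ltr0n stirling2_gt0// k0 leq_addr. Qed.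

(** The induction starts at [k = 1], where all values are [1]: [geo_lc] asks for positive terms, and
    [complete 0] vanishes in positive degree. *)
Lemma complete_lc k n : (0 < k)%N ->
  complete k n * complete k n.+2 <= complete k n.+1 ^+ 2.
Proof.
case: k => // k _; elim: k n => [|k IHk] n; last first.
  exact: (geo_lc (fun m => complete_gt0 m (ltn0Sn k)) IHk n (ler0n _ _)).
have E m : complete 1 m = 1.
  by elim: m => //= m ->; rewrite add0r mulr1.
by rewrite !E expr2.
Qed.

(* Euler's relation [z F'(z) = F(z) \sum_j j z / (1 - j z)] for
   [F(z) = \prod_(1 <= j <= k) 1 / (1 - j z)]. *)
Lemma complete_euler k n :
  n.+1%:R * complete k n.+1 = \sum_(0 <= j < k) j.+1%:R * geo j.+1%:R (complete k) n.
Proof.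
elim: k n => [|k IHk] n; first by rewrite big_nil mulr0.
rewrite big_nat_recr//; set K := k.+1%:R; set c := complete k.
rewrite -[complete k.+1]/(geo K c).
elim: n => [|n IHn].
  have := IHk 0%N; rewrite !mul1r -/c geoS => ->.
  by congr (_ + _); apply: eq_bigr.
(* The three terms belong to the outer induction hypothesis, to the inner one, and to the summand of
   the new variable. *)
rewrite geoS (_ : _ * _ = n.+2%:R * c n.+2 + K * (n.+1%:R * geo K c n.+1) +
   K * geo K c n.+1); last by rewrite -[n.+2%:R]natr1; ring.
rewrite IHn /c IHk -/c [geo K (geo K c) n.+1]geoS.
under [in RHS]eq_bigr do rewrite geo_geoS mulrDr.
rewrite big_split /= mulrDr mulr_sumr.
under [in X in _ = _ + X + _]eq_bigr do rewrite mulrCA.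
by ring.
Qed.

(* [x + k.+1] is the ratio of two consecutive values of [complete k.+1]. Such a
   ratio does not decrease when a variable is added, and is monotone in the added
   variable; so it compares with the ratios of [geo j (complete k.+1)] and of
   [geo j (complete k)] occurring in Euler's relation. *)
Lemma stirling2_ratio_sum n k : (0 < k < n)%N ->
  let x : R := (stirling2 n k)%:R / (stirling2 n k.+1)%:R in
  (x + k.+1%:R) * \sum_(0 <= i < k) (x + i.+1%:R)^-1 <= n%:R /\
  n.+1%:R <= (x + k.+1%:R) * \sum_(0 <= i < k.+1) (x + i%:R)^-1.
Proof.
move=> /andP[k0 kn] x.
have [N nE] : exists N, n = (k.+1 + N)%N by exists (n - k.+1)%N; rewrite subnKC.
have b0 : 0 < (stirling2 n k.+1)%:R :> R by rewrite ltr0n stirling2_gt0.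
have x0 : 0 < x by rewrite divr_gt0// ltr0n stirling2_gt0// k0 ltnW.
pose h := x + k.+1%:R.
have hE : complete k.+1 N.+1 = h * complete k.+1 N.
  rewrite !completeE addnS -nE stirling2S mul1n natrD natrM /h /x mulrDl.
  by rewrite mulfVK ?gt_eqF// addrC.
have K0 m : 0 < complete k.+1 m by exact: complete_gt0.
have c0 m : 0 < complete k m by exact: complete_gt0.
have Klc m : complete k.+1 m * complete k.+1 m.+2 <= complete k.+1 m.+1 ^+ 2.
  exact: complete_lc.
have clc m : complete k m * complete k m.+2 <= complete k m.+1 ^+ 2.
  exact: complete_lc.
have hj j : (j < k.+1)%N -> 0 < h - j.+1%:R.
  by move=> jk; rewrite subr_gt0 /h ltr_pwDl// ler_nat.
have nN : (n%:R : R) = N%:R + k.+1%:R by rewrite nE natrD addrC.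
(* By [geoS], the bound for one summand of Euler's relation says that the ratio of
   [geo j.+1%:R (complete k)] at [N] is at most [h], its value for the larger variable [k.+1]. For
   [up] the ratio of [geo j.+1%:R (complete k.+1)] is at least [h]. *)
have lo : \sum_(0 <= j < k) j.+1%:R / (h - j.+1%:R) <= N.+1%:R.
  rewrite -(ler_pM2r (c0 N.+1)) complete_euler mulr_suml.
  apply: ler_sum_nat => j /andP[_ jk]; rewrite -mulrA ler_wpM2l//.
  have hj' := hj j (ltnW jk); rewrite mulrC ler_pdivrMr//.
  have := geo_ratio_homo c0 clc N (ler0n _ j.+1) (_ : j.+1%:R <= k.+1%:R).
  rewrite ler_nat => /(_ (ltnW jk)).
  rewrite -[geo k.+1%:R (complete k)]/(complete k.+1) hE mulrAC.
  rewrite (ler_pM2r (K0 N)) /=; lra.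
have up : N.+1%:R <= \sum_(0 <= j < k.+1) j.+1%:R / (h - j.+1%:R).
  rewrite -(ler_pM2r (K0 N.+1)) complete_euler mulr_suml.
  apply: ler_sum_nat => j /andP[_ jk]; rewrite -[leRHS]mulrA ler_wpM2l//.
  have hj' := hj j jk; rewrite [leRHS]mulrC ler_pdivlMr//.
  have := geo_ratio K0 Klc N (ler0n _ j.+1).
  rewrite {1}hE mulrAC (ler_pM2r (K0 N)) /=; lra.
(* The constants [1] add up to the number of summands and complete [N] to [n]; reversing the sum
   turns the denominators [h - j.+1%:R] into [x + i]. *)
have frac j : (j < k.+1)%N -> j.+1%:R / (h - j.+1%:R) = h * (h - j.+1%:R)^-1 - 1.
  move=> /hj /gt_eqF/negbT hj0; apply: (mulIf hj0).
  by rewrite mulrBl !mulfVK// mul1r opprB addrC subrK.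
split.
  move: lo; rewrite (eq_big_nat _ _ (F2 := fun j => h * (h - j.+1%:R)^-1 - 1)); last first.
    by move=> j /andP[_ jk]; apply: frac; exact: ltnW.
  rewrite sumrB -mulr_sumr big_nat_rev /= sumr_const_nat subn0 add0n.
  rewrite (eq_big_nat _ _ (F2 := fun j => (x + j.+1%:R)^-1)); last first.
    move=> j /andP[_ jk]; congr (_^-1); rewrite /h subnSK// natrB ?(ltnW jk)//.
    by rewrite -!natr1; ring.
  rewrite nN -/h -!natr1; lra.
move: up; rewrite (eq_big_nat _ _ (F2 := fun j => h * (h - j.+1%:R)^-1 - 1)); last first.
  by move=> j /andP[_ jk]; exact: frac.
rewrite sumrB -mulr_sumr big_nat_rev /= sumr_const_nat subn0 add0n.
rewrite (eq_big_nat _ _ (F2 := fun j => (x + j%:R)^-1)); last first.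
  move=> j /andP[_ jk]; congr (_^-1); rewrite /h subSS -subSn// natrB ?(ltnW jk)//.
  by ring.
rewrite -[n.+1%:R]natr1 nN -/h -!natr1; lra.
Qed.

End SecondKind.

From mathcomp Require Import all_classical all_reals all_analysis.
From mathcomp Require Import measurable_realfun.
Import numFieldNormedType.Exports.
Local Open Scope classical_set_scope.

(** * First-order expansions in [1 / sqrt n] *)

Section DeltaMethod.
Variable R : realType.
Implicit Types (u v : nat -> R) (k : nat -> nat).

Lemma cvgn_eq_near u v (l : R) : (\forall n \near \oo, u n = v n) ->
  u n @[n --> \oo] --> l -> v n @[n --> \oo] --> l.
Proof.
by move=> uv ul; apply: cvg_trans ul; exact: near_eq_cvg.
Qed.

Lemma cvgnD u v (l m : R) : u n @[n --> \oo] --> l -> v n @[n --> \oo] --> m ->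
  u n + v n @[n --> \oo] --> l + m.
Proof. exact: cvgD. Qed.

Lemma cvgnB u v (l m : R) : u n @[n --> \oo] --> l -> v n @[n --> \oo] --> m ->
  u n - v n @[n --> \oo] --> l - m.
Proof. exact: cvgB. Qed.

Lemma cvgnM u v (l m : R) : u n @[n --> \oo] --> l -> v n @[n --> \oo] --> m ->
  u n * v n @[n --> \oo] --> l * m.
Proof. exact: cvgM. Qed.

Lemma cvgn_sqrt_pinfty : (Num.sqrt n%:R : R) @[n --> \oo] --> +oo.
Proof.
apply/cvgryPge => A; near=> n; rewrite (le_trans (ler_norm A))// -sqrtr_sqr.
by rewrite ler_wsqrtr//; near: n; exact: nbhs_infty_ger.
Unshelve. all: by end_near. Qed.

Lemma cvgn_sqrtV : (Num.sqrt n%:R : R)^-1 @[n --> \oo] --> 0.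
Proof.
apply/gtr0_cvgV0; last exact: cvgn_sqrt_pinfty.
by exists 1%N => // n /= n0; rewrite sqrtr_gt0 ltr0n.
Qed.

Lemma sqrtn_gt0 (n : nat) : (0 < n)%N -> 0 < (Num.sqrt n%:R : R).
Proof. by rewrite sqrtr_gt0 ltr0n. Qed.

(* First-order expansion [u n = l + a / sqrt n + o(1 / sqrt n)]. *)
Definition dcvg u (l a : R) := Num.sqrt n%:R * (u n - l) @[n --> \oo] --> a.

Lemma dcvg_cvg u l a : dcvg u l a -> u n @[n --> \oo] --> l.
Proof.
move=> ul; have -> : l = a * 0 + l by rewrite mulr0 add0r.
apply: cvgn_eq_near (cvgnD (cvgnM ul cvgn_sqrtV) (cvg_cst l)).
exists 1%N => // n /= n0.
by rewrite mulrAC mulfV ?mul1r ?subrK// gt_eqF// sqrtn_gt0.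
Qed.

Lemma dcvg_near_eq u v l a : (\forall n \near \oo, u n = v n) ->
  dcvg u l a -> dcvg v l a.
Proof.
by move=> uv; apply: cvgn_eq_near; near=> n; congr (_ * (_ - _)); near: n.
Unshelve. all: by end_near. Qed.

Lemma dcvg_cst l : dcvg (fun=> l) l 0.
Proof.
rewrite /dcvg (_ : (fun n => _) = fun=> 0); first exact: cvg_cst.
by apply/funext => n; rewrite subrr mulr0.
Qed.

Lemma dcvg_sqrtV a : dcvg (fun n => a / Num.sqrt n%:R) 0 a.
Proof.
apply: cvgn_eq_near (cvg_cst a); exists 1%N => // n /= n0.
by rewrite subr0 mulrCA divff ?mulr1// gt_eqF// sqrtn_gt0.
Qed.

Lemma dcvg_invn : dcvg (fun n => n%:R^-1) 0 0.
Proof.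
apply: cvgn_eq_near cvgn_sqrtV; exists 1%N => // n /= n0.
have s0 := sqrtn_gt0 n0.
rewrite subr0 -{3}[n%:R]sqr_sqrtr// expr2 invfM mulrA mulfV ?mul1r//.
by rewrite gt_eqF.
Qed.

Lemma dcvgD u v l m a b : dcvg u l a -> dcvg v m b ->
  dcvg (fun n => u n + v n) (l + m) (a + b).
Proof.
move=> ul vm; apply: cvgn_eq_near (cvgnD ul vm).
by apply: nearW => n; ring.
Qed.

Lemma dcvgM u v l m a b : dcvg u l a -> dcvg v m b ->
  dcvg (fun n => u n * v n) (l * m) (a * m + l * b).
Proof.
move=> ul vm; have vc := dcvg_cvg vm.
apply: cvgn_eq_near (cvgnD (cvgnM ul vc) (cvgnM (cvg_cst l) vm)).
by apply: nearW => n; ring.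
Qed.

(** Caratheodory's form of the derivative, [f x - f l = g x * (x - l)] with [g] continuous at [l],
    makes this a product of limits. *)
Lemma dcvg_comp (f : R -> R) u (l a df : R) : is_derive l 1 f df -> dcvg u l a ->
  dcvg (fun n => f (u n)) (f l) (df * a).
Proof.
move=> /is_derive1_caratheodory[g [fg gc <-]] ul.
have guc : g (u n) @[n --> \oo] --> g l by exact: continuous_cvg gc (dcvg_cvg ul).
apply: cvgn_eq_near (cvgnM guc ul).
by apply: nearW => n; rewrite fg; ring.
Qed.

Lemma dcvg_ln u l a : 0 < l -> dcvg u l a -> dcvg (fun n => ln (u n)) (ln l) (a / l).
Proof. by move=> l0 /(dcvg_comp (is_derive1_ln l0)); rewrite mulrC. Qed.

Lemma dcvg_expR (b : R) : dcvg (fun n => expR (b / Num.sqrt n%:R)) 1 b.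
Proof.
have := dcvg_comp (is_derive_expR 0) (@dcvg_sqrtV b).
by rewrite expR0 mul1r.
Qed.

Lemma dcvg_lt u v l a b : dcvg u l a -> dcvg v l b -> a < b ->
  \forall n \near \oo, u n < v n.
Proof.
move=> ul vl ab; have := cvgnB vl ul => /cvgr_gt/(_ 0).
rewrite subr_gt0 => /(_ ab) H; near=> n.
have n0 : (0 < n)%N by near: n; exists 1%N.
have : 0 < Num.sqrt n%:R * (v n - l) - Num.sqrt n%:R * (u n - l) by near: n; exact: H.
by rewrite -mulrBr pmulr_rgt0 ?sqrtn_gt0//; lra.
Unshelve. all: by end_near. Qed.

(** The Stirling ratios are known only through inequalities; this criterion lets them be tested
    against the explicit values [expR (b / Num.sqrt n%:R)]. *)
Lemma cvg_sqrt_ln (r : nat -> R) (l : R) :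
  (forall b, l < b -> \forall n \near \oo, r n < expR (b / Num.sqrt n%:R)) ->
  (forall b, b < l -> \forall n \near \oo, expR (b / Num.sqrt n%:R) < r n) ->
  Num.sqrt n%:R * ln (r n) @[n --> \oo] --> l.
Proof.
move=> ub lb; apply/cvgrPdist_lt => e e0.
have ub' := ub (l + e) (ltr_pwDr e0 (lexx _)).
have lb' : \forall n \near \oo, expR ((l - e) / Num.sqrt n%:R) < r n.
  by apply: lb; rewrite ltrBlDr ltrDl.
near=> n.
have n0 : (0 < n)%N by near: n; exists 1%N.
have s0 := sqrtn_gt0 n0.
have U : r n < expR ((l + e) / Num.sqrt n%:R) by near: n.
have L : expR ((l - e) / Num.sqrt n%:R) < r n by near: n.
have r0 : 0 < r n by apply: lt_trans L; exact: expR_gt0.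
move: U L; rewrite -{1}[r n]lnK// -{2}[r n]lnK// !ltr_expR ltr_pdivlMr// ltr_pdivrMr//.
by move=> U L; rewrite ltr_norml; apply/andP; split; lra.
Unshelve. all: by end_near. Qed.

End DeltaMethod.

(** * Comparison of harmonic sums with logarithms *)

Section HarmonicSums.
Variable R : realType.
Implicit Types (x : R) (n : nat).

(** The logarithm telescopes and each factor is bounded by [ln (1 + y) <= y]; in [sum_inv_le_ln]
    this is applied to the inverse factor. *)
Lemma ln_le_sum_inv x n : 0 < x ->
  ln ((x + n%:R) / x) <= \sum_(0 <= i < n) (x + i%:R)^-1.
Proof.
move=> x0; elim: n => [|n IHn]; first by rewrite big_nil addr0 divff ?gt_eqF// ln1.
have xn : 0 < x + n%:R by rewrite ltr_wpDr.
have xn1 : 0 < x + n.+1%:R by rewrite ltr_wpDr.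
rewrite big_nat_recr//= (_ : _ / x = (x + n%:R) / x * ((x + n.+1%:R) / (x + n%:R))); last first.
  by field; rewrite !gt_eqF.
rewrite lnM ?posrE ?divr_gt0// lerD//.
rewrite (_ : _ / _ = 1 + (x + n%:R)^-1); last by rewrite -natr1; field; rewrite gt_eqF.
by rewrite le_ln1Dx// (lt_trans (ltrN10 R))// invr_gt0.
Qed.

Lemma sum_inv_le_ln x n : 0 < x ->
  \sum_(0 <= i < n) (x + i.+1%:R)^-1 <= ln ((x + n%:R) / x).
Proof.
move=> x0; elim: n => [|n IHn]; first by rewrite big_nil addr0 divff ?gt_eqF// ln1.
have xn : 0 < x + n%:R by rewrite ltr_wpDr.
have xn1 : 0 < x + n.+1%:R by rewrite ltr_wpDr.
rewrite big_nat_recr//= (_ : _ / x = (x + n%:R) / x * ((x + n.+1%:R) / (x + n%:R))); last first.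
  by field; rewrite !gt_eqF.
rewrite lnM ?posrE ?divr_gt0// lerD//.
rewrite -[X in ln X]invrK lnV ?posrE ?invr_gt0 ?divr_gt0// lerNr.
rewrite invf_div (_ : _ / _ = 1 + - (x + n.+1%:R)^-1); last first.
  by rewrite -natr1; field; rewrite natr1 gt_eqF.
rewrite le_ln1Dx// ltrN2 invf_lt1//.
by rewrite -natr1 addrA ltrDr.
Qed.

End HarmonicSums.

(** * Asymptotics of the ratios *)

Section RatioLimits.
Variable R : realType.
Implicit Types (x y vt : R) (k : nat -> nat).

Lemma ln1Dx_lt x : -1 < x -> x != 0 -> ln (1 + x) < x.
Proof.
by move=> x1 x0; rewrite -ltr_expR lnK ?expR_gt1Dx// posrE; lra.
Qed.

Lemma mu1_gt0 vt : 0 < vt -> 0 < mu1 vt.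
Proof.
by move=> t0; rewrite mulr_gt0// ln_gt0// ltrDl invr_gt0.
Qed.

Lemma mu1_lt1 vt : 0 < vt -> mu1 vt < 1.
Proof.
move=> t0; rewrite /mu1 mulrC -ltr_pdivlMr// div1r ln1Dx_lt ?invr_neq0 ?gt_eqF//.
by rewrite (lt_trans (ltrN10 R))// invr_gt0.
Qed.

Lemma var1_gt0 vt : 0 < vt -> 0 < var1 vt.
Proof.
move=> t0; rewrite /var1 -mulrBr mulr_gt0// subr_gt0.
have t1 : 0 < 1 + vt by rewrite addr_gt0.
rewrite -ltrN2 -lnV ?posrE ?addr_gt0 ?invr_gt0//.
have -> : (1 + vt^-1)^-1 = 1 + - (1 + vt)^-1.
  by field; rewrite !gt_eqF//= 1?addrC// ltr_wpDr.
apply: ln1Dx_lt; last by rewrite oppr_eq0 invr_eq0 gt_eqF.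
by rewrite ltrN2 invf_lt1// ltrDl.
Qed.

Lemma near_natr_itv k (c a : R) : 0 < c < 1 ->
  dcvg (fun n => (k n)%:R / n%:R) c a ->
  \forall n \near \oo, (0 < k n < n)%N.
Proof.
move=> /andP[c0 c1] /dcvg_cvg kc.
have lo : \forall n \near \oo, 0 < (k n)%:R / n%:R :> R.
  exact: cvgr_gt kc _ c0.
have hi : \forall n \near \oo, (k n)%:R / n%:R < 1 :> R.
  exact: cvgr_lt kc _ c1.
near=> n; have n0 : 0 < n%:R :> R by rewrite ltr0n; near: n; exists 1%N.
have : 0 < (k n)%:R / n%:R :> R by near: n.
have : (k n)%:R / n%:R < 1 :> R by near: n; exact: hi.
by rewrite ltr_pdivrMr// mul1r ltr_nat pmulr_lgt0 ?invr_gt0// ltr0n => -> ->.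
Unshelve. all: by end_near. Qed.

Lemma dcvg_natrS k (c a : R) : dcvg (fun n => (k n)%:R / n%:R) c a ->
  dcvg (fun n => (k n).+1%:R / n%:R) c a.
Proof.
move=> kc; have -> : c = c + 0 by rewrite addr0.
have -> : a = a + 0 by rewrite addr0.
apply: dcvg_near_eq (dcvgD kc (@dcvg_invn R)).
by apply: nearW => n; rewrite -[in RHS]natr1 mulrDl div1r.
Qed.

(** The sum in [stirling1_ratio_mean] is nondecreasing in the ratio. At the test value
    [xi b n * n%:R] it is about [n%:R * h (xi b n)], where [h vt = mu1 vt] and
    [vt * h' vt = var1 vt]. So the comparison with [k n] is decided by the sign of
    [a - var1 vt * b]. *)
Lemma stirling1_ratio_cvg vt k (a : R) : 0 < vt ->
  dcvg (fun n => (k n)%:R / n%:R) (mu1 vt) a ->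
  Num.sqrt n%:R * ln ((stirling1 n (k n))%:R / (stirling1 n (k n).+1)%:R / (vt * n%:R))
    @[n --> \oo] --> a / var1 vt.
Proof.
move=> t0 ka; have v0 := var1_gt0 t0.
have kn := near_natr_itv (introT andP (conj (mu1_gt0 t0) (mu1_lt1 t0))) ka.
pose xi b n : R := vt * expR (b / Num.sqrt n%:R).
have xi0 b n : 0 < xi b n by rewrite mulr_gt0// expR_gt0.
pose h x : R := x * (ln (x + 1) - ln x).
have hxi b : dcvg (fun n => h (xi b n)) (mu1 vt) (var1 vt * b).
  have xic : dcvg (xi b) vt (vt * b).
    by have := dcvgM (dcvg_cst vt) (@dcvg_expR _ b); rewrite mulr1 mul0r add0r.
  have := dcvgM xic (dcvgD (dcvg_ln (_ : 0 < vt + 1) (dcvgD xic (dcvg_cst 1)))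
    (dcvgM (dcvg_cst (-1)) (dcvg_ln t0 xic))).
  move=> /(_ (addr_gt0 t0 ltr01)).
  have mE : mu1 vt = vt * (ln (vt + 1) + -1 * ln vt).
    rewrite /mu1 (_ : 1 + vt^-1 = (vt + 1) / vt); last by field; rewrite gt_eqF.
    by rewrite ln_div ?posrE ?addr_gt0// mulN1r.
  rewrite -mE.
  rewrite (_ : _ + _ = var1 vt * b); last first.
    rewrite /var1 -/(mu1 vt) mE; field.
    by rewrite ?(gt_eqF t0) ?(gt_eqF (addr_gt0 t0 ltr01)) ?(gt_eqF (addr_gt0 ltr01 t0)).
  by apply: dcvg_near_eq; apply: nearW => n; rewrite /h mulN1r.
have hE x n : 0 < x -> (0 < n)%N -> n%:R * h x = x * n%:R * ln ((x * n%:R + n%:R) / (x * n%:R)).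
  move=> x0 n0; have n0' : 0 < n%:R :> R by rewrite ltr0n.
  rewrite /h -ln_div ?posrE ?addr_gt0// mulrA [n%:R * x]mulrC; congr (_ * ln _).
  by field; rewrite !gt_eqF.
have ratio n : (0 < k n < n)%N -> exists2 x : R, 0 < x &
    [/\ (stirling1 n (k n))%:R / (stirling1 n (k n).+1)%:R = x,
     (k n)%:R <= \sum_(0 <= j < n) x / (x + j%:R) &
     \sum_(0 <= j < n) x / (x + j%:R) <= (k n).+1%:R].
  move=> /[dup] /andP[k0 kn'] /(stirling1_ratio_mean R).
  set c := (stirling1 n (k n))%:R; set c' := (stirling1 n (k n).+1)%:R.
  have c0 : 0 < c by rewrite ltr0n stirling1_gt0// k0 ltnW.
  have c'0 : 0 < c' by rewrite ltr0n stirling1_gt0.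
  move=> [lo hi]; exists (c / c'); first by rewrite divr_gt0.
  have E j : c / c' / (c / c' + j%:R) = c / (c + j%:R * c').
    by field; rewrite !gt_eqF// ltr_wpDr// mulr_ge0// ltW.
  by split => //; under eq_bigr do rewrite E.
have homo x y n : 0 < x -> x <= y ->
    \sum_(0 <= j < n) x / (x + j%:R) <= \sum_(0 <= j < n) y / (y + j%:R).
  move=> x0 xy; have y0 := lt_le_trans x0 xy; apply: ler_sum => j _.
  rewrite ler_pdivrMr ?ltr_wpDr// mulrAC ler_pdivlMr ?ltr_wpDr//.
  by have := ler_wpM2r (ler0n R j) xy; nra.
apply: cvg_sqrt_ln => b bv.
  have ltS := dcvg_lt (dcvg_natrS ka) (hxi b) (_ : a < var1 vt * b).
  rewrite mulrC -ltr_pdivrMr// in ltS.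
  near=> n; have n0 : (0 < n)%N by near: n; exists 1%N.
  have n0' : 0 < n%:R :> R by rewrite ltr0n.
  have [|x x0 [-> _ hi]] := ratio n; first by near: n.
  rewrite ltr_pdivrMr ?mulr_gt0// mulrCA mulrA -/(xi b n) ltNge; apply/negP => Xx.
  have X0 : 0 < xi b n * n%:R by rewrite mulr_gt0.
  have := le_trans (homo _ _ n X0 Xx) hi; rewrite leNgt => /negP; apply.
  rewrite -mulr_sumr; apply: lt_le_trans (ler_wpM2l (ltW X0) (ln_le_sum_inv n X0)).
  rewrite -hE// mulrC -ltr_pdivrMr//.
  by near: n; exact: ltS.
(* The logarithm bounds the sum only from index [1] on; the summand at [0] equals [1], hence the
   correction [n%:R^-1]. *)
have hxiS : dcvg (fun n => h (xi b n) + n%:R^-1) (mu1 vt) (var1 vt * b).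
  by have := dcvgD (hxi b) (@dcvg_invn R); rewrite !addr0.
have ltS := dcvg_lt hxiS ka (_ : var1 vt * b < a).
rewrite mulrC -ltr_pdivlMr// in ltS.
near=> n; have n0 : (0 < n)%N by near: n; exists 1%N.
have n0' : 0 < n%:R :> R by rewrite ltr0n.
have [|x x0 [-> lo _]] := ratio n; first by near: n.
rewrite ltr_pdivlMr ?mulr_gt0// mulrCA mulrA -/(xi b n) ltNge; apply/negP => xX.
have X0 : 0 < xi b n * n%:R by rewrite mulr_gt0.
have := le_trans lo (homo _ _ n x0 xX); rewrite leNgt => /negP; apply.
rewrite -mulr_sumr (big_ltn n0) big_add1 addr0 mulrDr divff ?gt_eqF//.
apply: (@le_lt_trans _ _ (1 + n%:R * h (xi b n))).
  rewrite lerD2l hE// ler_wpM2l ?(ltW X0)//.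
  apply: le_trans (sum_inv_le_ln n X0).
  rewrite [leRHS](big_cat_nat (n := n.-1)) ?leq_pred//= lerDl sumr_ge0// => i _.
  by rewrite invr_ge0 addr_ge0 ?(ltW X0).
rewrite -(ltr_pM2r (_ : 0 < n%:R^-1)) ?invr_gt0// mulrDl mul1r mulrAC divff ?gt_eqF//.
rewrite mul1r addrC; near: n; exact: (ltS bv).
Unshelve. all: by end_near. Qed.

Lemma dcvg_divn (u : nat -> R) (l : R) : u n @[n --> \oo] --> l ->
  dcvg (fun n => u n / n%:R) 0 0.
Proof.
move=> ul; have /cvgnM/(_ (@dcvg_invn R)) := ul; rewrite mulr0; apply: cvgn_eq_near.
by apply: nearW => n; rewrite !subr0; ring.
Qed.

Lemma dcvg_mul_ln (s t : nat -> R) (s0 t0 s' t' : R) : 0 < s0 -> 0 < t0 ->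
  dcvg s s0 s' -> dcvg t t0 t' ->
  dcvg (fun n => s n * (ln (s n) - ln (t n))) (s0 * (ln s0 - ln t0))
    (s' * (ln s0 - ln t0 + 1) - s0 / t0 * t').
Proof.
move=> s00 t00 ss tt.
have := dcvgM ss (dcvgD (dcvg_ln s00 ss) (dcvgM (dcvg_cst (-1)) (dcvg_ln t00 tt))).
rewrite mulN1r (_ : _ + _ * _ = s' * (ln s0 - ln t0 + 1) - s0 / t0 * t'); last first.
  by field; rewrite ?(gt_eqF s00) ?(gt_eqF t00).
by apply: dcvg_near_eq; apply: nearW => n; rewrite mulN1r.
Qed.

(** Each quotient [(x + K) / (x + c i)] is nonincreasing in [x] because [c i <= K]. *)
Lemma stirling2_ratio_homo (x y K : R) (c : nat -> R) m : 0 < x -> x <= y ->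
  (forall i, (i < m)%N -> 0 <= c i <= K) ->
  (y + K) * \sum_(0 <= i < m) (y + c i)^-1 <= (x + K) * \sum_(0 <= i < m) (x + c i)^-1.
Proof.
move=> x0 xy cK; rewrite !mulr_sumr; apply: ler_sum_nat => i /andP[_ /cK/andP[c0 cK']].
rewrite ler_pdivrMr; last by lra.
rewrite mulrAC ler_pdivlMr; last by lra.
nra.
Qed.

(** * The ratio of the second kind against a test sequence *)

Section SecondKindRatio.
Variables (k : nat -> nat) (xi : nat -> R) (xi0 c xi' a : R).
Hypotheses (xi0_gt0 : 0 < xi0) (c_itv : 0 < c < 1).
Hypothesis psi1 : (xi0 + c) * (ln (xi0 + c) - ln xi0) = 1.
Hypothesis xiP : dcvg xi xi0 xi'.
Hypothesis kP : dcvg (fun n => (k n)%:R / n%:R) c a.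

(** The coefficient of [1 / sqrt n] in [s * (ln s - ln (xi n))] for [s = xi n + (k n).+1%:R / n%:R].
    The constant term is [1] by [psi1], so the sign of [D] decides the comparison. *)
Let D := (xi' + a) * (ln (xi0 + c) - ln xi0 + 1) - (xi0 + c) / xi0 * xi'.
Let X n := xi n * n%:R.

Let near_xi_gt0 : \forall n \near \oo, 0 < xi n.
Proof. exact: cvgr_gt (dcvg_cvg xiP) _ xi0_gt0. Qed.

Let near_k := near_natr_itv c_itv kP.

Let xc_gt0 : 0 < xi0 + c.
Proof. by case/andP: c_itv => c0 _; rewrite addr_gt0. Qed.

Let sP : dcvg (fun n => xi n + (k n).+1%:R / n%:R) (xi0 + c) (xi' + a).
Proof. exact: dcvgD xiP (dcvg_natrS kP). Qed.

Lemma stirling2_ratio_lt : D < 0 -> \forall n \near \oo,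
  (stirling2 n (k n))%:R / (stirling2 n (k n).+1)%:R < xi n * n%:R.
Proof.
move=> D0; have F1 := dcvg_mul_ln xc_gt0 xi0_gt0 sP xiP.
(* The summand at [0], which the logarithm does not cover, contributes this quotient divided by [n],
   of smaller order than [1 / sqrt n]. *)
have uc : (xi n + (k n).+1%:R / n%:R) / xi n @[n --> \oo] --> (xi0 + c) / xi0.
  apply: cvgnM; first exact: dcvg_cvg sP.
  by apply: cvgV; [rewrite gt_eqF|exact: dcvg_cvg xiP].
have := dcvgD F1 (dcvg_divn uc); rewrite psi1 !addr0 => F.
have {F} ltS := dcvg_lt F (dcvg_cst 1) D0.
near=> n; have n0 : (0 < n)%N by near: n; exists 1%N.
have n0' : 0 < n%:R :> R by rewrite ltr0n.
have x0 : 0 < xi n by near: n.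
have kn : (0 < k n < n)%N by near: n.
have [_] := stirling2_ratio_sum R kn.
set x := _%:R / _; rewrite ltNge => hi; apply/negP => Xx.
have X0 : 0 < X n by rewrite mulr_gt0.
have K0 : 0 < (k n).+1%:R :> R by rewrite ltr0n.
have s0 : 0 < xi n + (k n).+1%:R / n%:R by rewrite addr_gt0// divr_gt0.
have cK i : (i < (k n).+1)%N -> 0 <= (i%:R : R) <= (k n).+1%:R.
  by move=> iK; rewrite ler0n ler_nat ltnW.
have := le_trans hi (stirling2_ratio_homo X0 Xx cK).
rewrite leNgt => /negP; apply.
apply: (@lt_trans _ _ n%:R); last by rewrite ltr_nat.
have XK : X n + (k n).+1%:R = (xi n + (k n).+1%:R / n%:R) * n%:R.
  by rewrite mulrDl mulfVK ?gt_eqF.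
apply: (@le_lt_trans _ _ ((X n + (k n).+1%:R) * ((X n)^-1 +
   (ln (xi n + (k n).+1%:R / n%:R) - ln (xi n))))).
  rewrite ler_wpM2l ?addr_ge0 ?(ltW X0)//.
  rewrite big_ltn// big_add1 addr0 lerD2l.
  apply: (@le_trans _ _ (\sum_(0 <= i < (k n).+1) (X n + i.+1%:R)^-1)).
    rewrite [leRHS]big_nat_recr//= lerDl invr_ge0.
    by rewrite addr_ge0 ?(ltW X0).
  apply: (le_trans (sum_inv_le_ln _ X0)).
  rewrite -ln_div ?posrE// XK /X invfM mulrACA divff ?gt_eqF// mulr1.
  exact: lexx.
rewrite XK -[ltRHS]mul1r mulrAC ltr_pM2r// mulrDr addrC /X invfM mulrA.
by near: n; exact: ltS.
Unshelve. all: by end_near. Qed.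

Lemma stirling2_ratio_gt : 0 < D -> \forall n \near \oo,
  xi n * n%:R < (stirling2 n (k n))%:R / (stirling2 n (k n).+1)%:R.
Proof.
(* The sum here starts at [1], so that the logarithm starts at [X n + 1]; the shift of [xi] by
   [n%:R^-1] does not affect its expansion. *)
move=> D0; have := dcvgD xiP (@dcvg_invn R); rewrite !addr0 => tP.
have := dcvg_mul_ln xc_gt0 xi0_gt0 sP tP; rewrite psi1 => F.
have {F} ltS := dcvg_lt (dcvg_cst 1) F D0.
near=> n; have n0 : (0 < n)%N by near: n; exists 1%N.
have n0' : 0 < n%:R :> R by rewrite ltr0n.
have x0 : 0 < xi n by near: n.
have kn : (0 < k n < n)%N by near: n.
have [+ _] := stirling2_ratio_sum R kn.
set x := _%:R / _; rewrite ltNge => lo; apply/negP => xX.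
have X0 : 0 < X n by rewrite mulr_gt0.
have xx0 : 0 < x.
  case/andP: kn => k0 kn'.
  by rewrite divr_gt0// ltr0n stirling2_gt0 ?k0//= ltnW.
have K0 : 0 < (k n).+1%:R :> R by rewrite ltr0n.
have s0 : 0 < xi n + (k n).+1%:R / n%:R by rewrite addr_gt0// divr_gt0.
have t0 : 0 < xi n + n%:R^-1 by rewrite addr_gt0// invr_gt0.
have XK : X n + (k n).+1%:R = (xi n + (k n).+1%:R / n%:R) * n%:R.
  by rewrite mulrDl mulfVK ?gt_eqF.
have X1 : X n + 1 = (xi n + n%:R^-1) * n%:R by rewrite mulrDl mulVf ?gt_eqF.
have cK i : (i < k n)%N -> 0 <= (i.+1%:R : R) <= (k n).+1%:R.
  by move=> iK; rewrite ler0n ler_nat ltnW.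
have := le_trans (stirling2_ratio_homo xx0 xX cK) lo.
rewrite leNgt => /negP; apply.
apply: (@lt_le_trans _ _ ((X n + (k n).+1%:R) *
   (ln (xi n + (k n).+1%:R / n%:R) - ln (xi n + n%:R^-1)))).
  rewrite XK -[ltLHS]mul1r mulrAC ltr_pM2r//.
  by near: n; exact: ltS.
rewrite ler_wpM2l ?addr_ge0 ?(ltW X0)//.
under eq_bigr do rewrite -natr1 [_ + 1]addrC addrA.
have X10 : 0 < X n + 1 by rewrite addr_gt0.
apply: le_trans (ln_le_sum_inv (k n) X10).
rewrite -ln_div ?posrE// -addrA [1 + _]addrC natr1 XK X1.
by rewrite invfM mulrACA divff ?gt_eqF// mulr1.
Unshelve. all: by end_near. Qed.

End SecondKindRatio.

(** [rho n * n%:R] stands for the quotient of consecutive weights of the law. The last hypothesis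
    evaluates [D] for the test sequence [rho n * expR (b / Num.sqrt n%:R)]: it changes sign at
    [b = a / v], and [q] is a positive factor free to choose. *)
Lemma stirling2_ratio_cvg k (rho : nat -> R) (rho0 rho' c a v q : R) :
  0 < rho0 -> 0 < c < 1 -> 0 < v -> 0 < q ->
  (rho0 + c) * (ln (rho0 + c) - ln rho0) = 1 ->
  dcvg rho rho0 rho' -> dcvg (fun n => (k n)%:R / n%:R) c a ->
  (forall b, (rho0 * b + rho' + a) * (ln (rho0 + c) - ln rho0 + 1) -
     (rho0 + c) / rho0 * (rho0 * b + rho') = q * (a - b * v)) ->
  Num.sqrt n%:R * ln ((stirling2 n (k n))%:R / (stirling2 n (k n).+1)%:R /
    (rho n * n%:R)) @[n --> \oo] --> a / v.
Proof.
move=> rho00 c01 v0 q0 psi1 rhoP kP DE.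
have rho_gt0 : \forall n \near \oo, 0 < rho n by exact: cvgr_gt (dcvg_cvg rhoP) _ rho00.
pose xi b n : R := rho n * expR (b / Num.sqrt n%:R).
have xiP b : dcvg (xi b) rho0 (rho0 * b + rho').
  by have := dcvgM rhoP (@dcvg_expR _ b); rewrite !mulr1 addrC.
apply: cvg_sqrt_ln => b bv.
  have lt0 : q * (a - b * v) < 0.
    by rewrite pmulr_rlt0// subr_lt0 -ltr_pdivrMr.
  rewrite -DE in lt0.
  have := stirling2_ratio_lt rho00 c01 psi1 (xiP b) kP lt0.
  move=> ltS; near=> n; have n0 : (0 < n)%N by near: n; exists 1%N.
  have r0 : 0 < rho n by near: n.
  rewrite ltr_pdivrMr ?mulr_gt0 ?ltr0n// mulrA [X in _ < X * _]mulrC.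
  by near: n; exact: ltS.
have lt0 : 0 < q * (a - b * v) by rewrite mulr_gt0// subr_gt0 -ltr_pdivlMr.
rewrite -DE in lt0.
have := stirling2_ratio_gt rho00 c01 psi1 (xiP b) kP lt0.
move=> ltS; near=> n; have n0 : (0 < n)%N by near: n; exists 1%N.
have r0 : 0 < rho n by near: n.
rewrite ltr_pdivlMr ?mulr_gt0 ?ltr0n// mulrA [X in X * _ < _]mulrC.
by near: n; exact: ltS.
Unshelve. all: by end_near. Qed.

(** A solution exists in [[0, x]] since [x <= x * expR x]; the chosen one has the sign of [x], as
    [expR] is positive. *)
Lemma lambertW0P x : 0 < x -> 0 < lambertW0 x /\ lambertW0 x * expR (lambertW0 x) = x.
Proof.
move=> x0; have ex : exists w, [set w | -1 < w /\ w * expR w = x] w.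
  have [||w] := @IVT R (fun w => w * expR w) 0 x x (ltW x0).
  - apply: continuous_subspaceT => z; apply: cvgM; first exact: cvg_id.
    exact: continuous_expR.
  - rewrite mul0r; have xx : x <= x * expR x.
      by rewrite ler_peMr ?(ltW x0)// -expR0 ler_expR ltW.
    by rewrite ge_min le_max (ltW x0) xx orbT.
  rewrite in_itv/= => /andP[w0 _] wE; exists w; split => //.
  by rewrite (lt_le_trans _ w0).
have [_ wE] := xgetPex 0 ex; split=> //; rewrite -wE in x0.
by rewrite -(pmulr_lgt0 _ (expR_gt0 (lambertW0 x))).
Qed.

(** * Constants of the second law *)

Section SecondLaw.
Variable vt : R.
Hypothesis vt0 : 0 < vt.
Let w := lambertW0 vt^-1.

Let w_gt0 : 0 < w.
Proof. by have [] := @lambertW0P vt^-1; rewrite ?invr_gt0. Qed.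

Let wE : w^-1 = vt * expR w.
Proof.
have [|_] := @lambertW0P vt^-1; first by rewrite invr_gt0.
rewrite -/w => /(canRL (mulKf (lt0r_neq0 w_gt0))) ->.
by rewrite mulrCA divff ?mulr1// gt_eqF.
Qed.

Lemma mu2_itv : 0 < mu2 vt < 1.
Proof.
have w0 := w_gt0; rewrite /mu2 -/w wE -{2 4}[vt]mulr1 -mulrBr; apply/andP; split.
  by rewrite mulr_gt0// subr_gt0 expR_gt1.
(* The claim becomes [expR w * (1 - w) < 1]. *)
rewrite [ltRHS](_ : 1 = w * (vt * expR w)); last by rewrite -wE divff ?gt_eqF.
rewrite mulrCA ltr_pM2l//.
have : expR w * (1 - w) < expR w * expR (- w).
  by rewrite ltr_pM2l ?expR_gt0// expR_gt1Dx// oppr_eq0 gt_eqF.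
by rewrite -expRD subrr expR0; lra.
Qed.

Lemma var2_gt0 : 0 < var2 vt.
Proof.
have w0 := w_gt0; have w10 : 0 < 1 + w by rewrite addr_gt0.
rewrite /var2 -/w invfM wE subr_gt0 -[ltLHS]mulr1 -mulrA ltr_pM2l//.
by rewrite ltr_pdivlMr// mul1r expR_gt1Dx// gt_eqF.
Qed.

(** Here [rho] is constantly [vt]. As [vt + mu2 vt = vt * expR w], the logarithm is [w], the
    equation for [rho0] reads [vt * expR w * w = 1], and [q = 1 + w]. *)
Lemma stirling2_law2_ratio_cvg k (a : R) :
  dcvg (fun n => (k n)%:R / n%:R) (mu2 vt) a ->
  Num.sqrt n%:R * ln ((stirling2 n (k n))%:R / (stirling2 n (k n).+1)%:R / (vt * n%:R))
    @[n --> \oo] --> a / var2 vt.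
Proof.
move=> ka; have w0 := w_gt0; have w10 : 0 < 1 + w by rewrite addr_gt0.
have mE : vt + mu2 vt = vt * expR w by rewrite /mu2 -/w wE addrC subrK.
have lE : ln (vt + mu2 vt) - ln vt = w.
  by rewrite mE lnM ?posrE ?expR_gt0// expRK addrC addKr.
apply: (stirling2_ratio_cvg (rho := fun=> vt) vt0 mu2_itv var2_gt0 w10 _ (@dcvg_cst _ vt) ka).
  by rewrite lE mE -wE mulVf ?gt_eqF.
move=> b; rewrite lE mE -wE addr0 /var2 -/w.
by field; rewrite ?(gt_eqF vt0) ?(gt_eqF w0) ?(gt_eqF w10).
Qed.

End SecondLaw.

(** * Constants of the third law *)

Section ThirdLaw.
Variable vt : R.
Hypothesis vt0 : 0 < vt.
Let e : R := expR (- vt^-1).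

Let e_gt0 : 0 < e. Proof. exact: expR_gt0. Qed.

Lemma mu3_itv : 0 < mu3 vt < 1.
Proof.
rewrite /mu3 -/e; apply/andP; split.
  by rewrite mulr_gt0// subr_gt0 expR_lt1 oppr_lt0 invr_gt0.
rewrite mulrC -ltr_pdivlMr// div1r ltrBlDr addrC -ltrBlDr.
by rewrite expR_gt1Dx// oppr_eq0 invr_eq0 gt_eqF.
Qed.

Lemma var3_gt0 : 0 < var3 vt.
Proof.
rewrite /var3 -/e mulr_gt0// ?mulr_gt0// -addrA -opprD -{1}[e]mul1r -mulrDl subr_gt0.
rewrite -ltr_pdivlMr// div1r -expRN opprK expR_gt1Dx//.
by rewrite invr_eq0 gt_eqF.
Qed.

(** The weight quotient now depends on [k]: [rho n = vt - (k n)%:R / n%:R], with limit [vt * e] and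
    first-order coefficient [- a]. As [vt * e + mu3 vt = vt], the logarithm is [vt^-1]; here
    [q = e^-1]. *)
Lemma stirling2_law3_ratio_cvg k (a : R) :
  dcvg (fun n => (k n)%:R / n%:R) (mu3 vt) a ->
  Num.sqrt n%:R * ln ((stirling2 n (k n))%:R / (stirling2 n (k n).+1)%:R /
    (vt * n%:R - (k n)%:R)) @[n --> \oo] --> a / var3 vt.
Proof.
move=> ka; have e0 := e_gt0; have mE : vt * e + mu3 vt = vt by rewrite /mu3 -/e; ring.
have lE : ln (vt * e + mu3 vt) - ln (vt * e) = vt^-1.
  by rewrite mE lnM ?posrE// /e expRK; ring.
have rP : dcvg (fun n => vt - (k n)%:R / n%:R) (vt * e) (- a).
  have := dcvgD (dcvg_cst vt) (dcvgM (dcvg_cst (-1)) ka).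
  rewrite !mulN1r mul0r !add0r (_ : vt - mu3 vt = vt * e); last by rewrite -{1}mE addrK.
  by apply: dcvg_near_eq; apply: nearW => n; rewrite mulN1r.
have := stirling2_ratio_cvg (mulr_gt0 vt0 e0) mu3_itv var3_gt0 (_ : 0 < e^-1) _ rP ka.
rewrite invr_gt0 lE mE divff ?gt_eqF// => /(_ e0 erefl) H.
have {}H := H _; apply: cvgn_eq_near (H _).
  exists 1%N => // n /= n0; congr (_ * ln (_ / _)).
  by rewrite mulrBl mulfVK// pnatr_eq0 -lt0n.
move=> b; rewrite /var3 -/e.
by field; rewrite ?(gt_eqF vt0) ?(gt_eqF e0).
Qed.

End ThirdLaw.

End RatioLimits.

(** * A local limit theorem for log-concave sequences *)

(** The concave sequence [ln q] lies below its line through [k] and [k.+1]; induction on the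
    distance from [k], on either side. *)
Lemma logconcave_tangent (R : realType) (q : nat -> R) (k m : nat) :
  logconcave q -> 0 < q k -> 0 < q k.+1 ->
  q m <= q k * expR (- ((m%:R - k%:R) * ln (q k / q k.+1))).
Proof.
move=> lcq qk qk1; set y := ln _.
have yE : expR (- y) * q k = q k.+1.
  by rewrite /y expRN lnK ?posrE ?divr_gt0// invf_div mulfVK// gt_eqF.
have [km|mk] := leqP k m.
  rewrite -(subnKC km); elim: (m - k)%N => [|i IHi].
    by rewrite addn0 subrr mul0r oppr0 expR0 mulr1.
  rewrite addnS; have lck := lcq k (k + i)%N (leq_addr _ _).
  rewrite -(ler_pM2l qk); apply: (le_trans lck).
  have -> : - (((k + i).+1%:R - k%:R) * y) = - (((k + i)%:R - k%:R) * y) - y.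
    by rewrite -natr1; ring.
  rewrite expRD -yE; have e0 := expR_gt0 (- y).
  have := ler_wpM2l (ltW (mulr_gt0 e0 qk)) IHi; lra.
rewrite -(subKn (ltnW mk)); have : (k - m <= k)%N by exact: leq_subr.
elim: (k - m)%N => [|i IHi] ik.
  by rewrite subn0 subrr mul0r oppr0 expR0 mulr1.
have lck := lcq (k - i.+1)%N k (leq_subr _ _).
have {}IHi := IHi (ltnW ik).
rewrite -(ler_pM2r qk1); apply: (le_trans lck).
have -> : - (((k - i.+1)%:R - k%:R) * y) = - (((k - i)%:R - k%:R) * y) + y.
  by rewrite -(subnSK ik) -[(k - i.+1).+1%:R]natr1; ring.
rewrite subnSK// expRD -yE.
have -> : q k * (expR (- (((k - i)%:R - k%:R) * y)) * expR y) * (expR (- y) * q k) =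
  q k * expR (- (((k - i)%:R - k%:R) * y)) * (expR y * expR (- y)) * q k by ring.
by rewrite -expRD subrr expR0 mulr1 ler_wpM2r// ltW.
Qed.

Lemma integral_step_function (R : realType) (c : nat -> R) (I : nat -> set R) (D : set R) m :
  (forall k, 0 <= c k) -> (forall k, measurable (I k)) -> measurable D ->
  (\int[lebesgue_measure]_(t in D) (\sum_(0 <= k < m) c k * \1_(I k) t)%:E =
   \sum_(0 <= k < m) (c k)%:E * lebesgue_measure (I k `&` D))%E.
Proof.
move=> c0 mI mD.
under eq_integral do rewrite -sumEFin.
rewrite ge0_integral_sum//; last 2 first.
- move=> k; apply/measurable_EFinP; apply: measurable_funM => //.
  by apply: measurable_indic; exact: mI.
- by move=> k t _; rewrite lee_fin mulr_ge0.
apply: eq_bigr => k _; under eq_integral do rewrite EFinM.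
rewrite ge0_integralZl_EFin//; last first.
  by apply/measurable_EFinP; apply: measurable_indic; exact: mI.
by rewrite integral_indic//; exact: mI.
Qed.

(** By symmetry it suffices to consider the half-line, where the function is twice the exponential
    density of rate [1 / 2]. *)
Lemma integrable_expR_abs (R : realType) :
  lebesgue_measure.-integrable [set: R] (fun t : R => (expR (- (`|t| / 2)))%:E).
Proof.
have cf : continuous (fun t : R => expR (- (`|t| / 2))).
  move=> t; apply: continuous_comp; last exact: continuous_expR.
  apply: (@continuousN R R^o R (fun t : R => `|t| / 2)).
  by apply: cvgM; [exact: norm_continuous|exact: cvg_cst].
have mf := continuous_measurable_fun cf.
apply/integrableP; split; first exact/measurable_EFinP.
under eq_integral do rewrite /= ger0_norm ?expR_ge0//.
rewrite ge0_symfun_integralT//; last by move=> t /=; rewrite normrN.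
rewrite (_ : [set x : R | 0 <= x] = `[0, +oo[%classic); last first.
  by apply/seteqP; split => x/=; rewrite in_itv/= andbT.
rewrite lte_mul_pinfty//.
apply: (@le_lt_trans _ _ (\int[lebesgue_measure]_(t in `[0%R, +oo[) (2%:E * (exponential_pdf 2^-1 t)%:E))%E).
  apply: ge0_le_integral => //=.
  - by apply/measurable_EFinP; exact: measurable_funTS.
  - apply: measurable_funTS; apply/measurable_EFinP.
    by apply: measurable_funM => //; exact: measurable_exponential_pdf.
  - move=> t; rewrite in_itv/= andbT => t0.
    rewrite lee_fin exponential_pdfE// ger0_norm// mulrA divff// mul1r.
    by rewrite mulNr mulrC.
rewrite ge0_integralZl_EFin//; last 2 first.
- by move=> t _; rewrite lee_fin exponential_pdf_ge0.
- by apply: measurable_funTS; apply/measurable_EFinP; exact: measurable_exponential_pdf.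
rewrite lte_mul_pinfty//.
apply: (@le_lt_trans _ _ (\int[lebesgue_measure]_t (exponential_pdf 2^-1 t)%:E)%E).
  apply: ge0_subset_integral => //.
  - by apply/measurable_EFinP; exact: measurable_exponential_pdf.
  - by move=> t _; rewrite lee_fin exponential_pdf_ge0.
by rewrite integral_exponential_pdf// ltry.
Qed.

Unset Implicit Arguments.

Section LocalLimit.
Variables (R : realType) (p : nat -> nat -> R) (mu sg : R).
Hypothesis p_n0 : forall n, (0 < n)%N -> p n 0 = 0.
Hypothesis p_gt : forall n k, (n < k)%N -> p n k = 0.
Hypothesis p_gt0 : forall n k, (0 < k <= n)%N -> 0 < p n k.
Hypothesis p_lc : forall n, (0 < n)%N -> logconcave (p n).
Hypothesis mu_itv : 0 < mu < 1.
Hypothesis sg_gt0 : 0 < sg.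
Hypothesis ratioP : forall (k : nat -> nat) (a : R),
  dcvg (fun n => (k n)%:R / n%:R) mu a ->
  Num.sqrt n%:R * ln (p n (k n) / p n (k n).+1) @[n --> \oo] --> a / sg ^+ 2.

Lemma p_ge0 n k : (0 < n)%N -> 0 <= p n k.
Proof.
move=> n0; case: k => [|k]; first by rewrite p_n0.
by have [kn|nk] := leqP k.+1 n; [rewrite ltW// p_gt0|rewrite p_gt].
Qed.

(* [idx n t] is the lattice point at [t] standard deviations from the mean. For
   negative [loc n t] the truncation gives [0], where [p n] vanishes as well. *)
Definition loc n (t : R) := mu * n%:R + t * (sg * Num.sqrt n%:R).
Definition idx n (t : R) := Num.truncn (loc n t).

Lemma near_loc_ge0 t : \forall n \near \oo, 0 <= loc n t.
Proof.
have [mu0 _] := andP mu_itv.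
have /cvgryPge/(_ (- (t * sg) / mu)) := @cvgn_sqrt_pinfty R.
move=> H; near=> n; rewrite /loc -{1}[n%:R]sqr_sqrtr// expr2 2!mulrA -mulrDl.
rewrite mulr_ge0// -[leLHS](subrr (t * sg)) addrC lerD2r -ler_pdivrMl//.
by rewrite mulrC; near: n; exact: H.
Unshelve. all: by end_near. Qed.

Lemma dcvg_idx t : dcvg (fun n => (idx n t)%:R / n%:R) mu (t * sg).
Proof.
have lo : t * sg - (Num.sqrt n%:R)^-1 @[n --> \oo] --> t * sg.
  rewrite -[X in _ --> X]subr0; apply: cvgnB; first exact: cvg_cst.
  exact: cvgn_sqrtV.
apply: squeeze_cvgr lo (cvg_cst (t * sg)).
near=> n; have n0 : (0 < n)%N by near: n; exists 1%N.
have s0 : 0 < Num.sqrt n%:R :> R by exact: sqrtn_gt0.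
have l0 : 0 <= loc n t by near: n; exact: near_loc_ge0.
have nE : n%:R = Num.sqrt n%:R ^+ 2 :> R by rewrite sqr_sqrtr.
have E (r m i : R) : 0 < r -> m = r ^+ 2 -> r * (i / m - mu) = (i - mu * m) / r.
  by move=> r0 ->; field; rewrite gt_eqF.
rewrite (E _ _ _ s0 nE).
have := truncn_itv l0; rewrite -/(idx n t) -natr1 /loc => /andP[i1 i2].
apply/andP; split.
  rewrite -[X in _ - X]mul1r -{1}(mulfK (lt0r_neq0 s0) (t * sg)) -mulrBl ler_pM2r ?invr_gt0//.
  lra.
rewrite ler_pdivrMr//; lra.
Unshelve. all: by end_near. Qed.

Lemma near_idx t : \forall n \near \oo, (0 < idx n t < n)%N.
Proof. exact: near_natr_itv mu_itv (dcvg_idx t). Qed.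

Let y n t := ln (p n (idx n t) / p n (idx n t).+1).

Lemma slope_cvg t : sg * Num.sqrt n%:R * y n t @[n --> \oo] --> t.
Proof.
rewrite [X in _ --> X](_ : t = sg * (t * sg / sg ^+ 2)); last first.
  by field; rewrite gt_eqF.
apply: cvgn_eq_near (cvgnM (cvg_cst sg) (ratioP _ _ (dcvg_idx t))).
by apply: nearW => n; rewrite mulrA.
Qed.

(** The drop of [ln (p n)] from [s] to [t] as predicted by the tangent at [s]. *)
Let A n s t := ((idx n t)%:R - (idx n s)%:R) * y n s.

Lemma increment_cvg s t : A n s t @[n --> \oo] --> (t - s) * s.
Proof.
have H : Num.sqrt n%:R * ((idx n t)%:R / n%:R - (idx n s)%:R / n%:R) @[n --> \oo] --> t * sg - s * sg.
  apply: cvgn_eq_near (cvgnB (dcvg_idx t) (dcvg_idx s)).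
  by apply: nearW => n; ring.
rewrite [X in _ --> X](_ : _ = (t * sg - s * sg) * (s * sg / sg ^+ 2)); last first.
  by field; rewrite gt_eqF.
apply: cvgn_eq_near (cvgnM H (ratioP _ _ (dcvg_idx s))); exists 1%N => // n /= n0; rewrite /A.
have s0 : 0 < Num.sqrt n%:R :> R by exact: sqrtn_gt0.
have nE : n%:R = Num.sqrt n%:R ^+ 2 :> R by rewrite sqr_sqrtr.
have E (r m i j z : R) : 0 < r -> m = r ^+ 2 -> r * (i / m - j / m) * (r * z) = (i - j) * z.
  by move=> r0 ->; field; rewrite gt_eqF.
by rewrite (E _ _ _ _ _ s0 nE).
Qed.

Let ell n t := ln (p n (idx n t)).

Lemma increment_le s t : \forall n \near \oo, A n s t <= ell n s - ell n t.
Proof.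
near=> n; have n0 : (0 < n)%N by near: n; exists 1%N.
have /andP[s1 s2] : (0 < idx n s < n)%N by near: n; exact: near_idx.
have /andP[t1 t2] : (0 < idx n t < n)%N by near: n; exact: near_idx.
have ps : 0 < p n (idx n s) by rewrite p_gt0// s1 ltnW.
have ps1 : 0 < p n (idx n s).+1 by rewrite p_gt0.
have pt : 0 < p n (idx n t) by rewrite p_gt0// t1 ltnW.
have := logconcave_tangent (idx n t) (p_lc _ n0) ps ps1.
rewrite -ler_ln ?posrE ?mulr_gt0 ?expR_gt0// lnM ?posrE ?expR_gt0// expRK.
by rewrite /A /ell /y; lra.
Unshelve. all: by end_near. Qed.

(* On an arithmetic progression the bounds [increment_le] add up to Riemann
   sums of [\int u du]. *)
Lemma drop_bounds (d : R) (m : nat) : exists lo up : nat -> R,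
  [/\ lo n @[n --> \oo] --> d ^+ 2 * (m%:R ^+ 2 - m%:R) / 2,
      up n @[n --> \oo] --> d ^+ 2 * (m%:R ^+ 2 + m%:R) / 2 &
      \forall n \near \oo, lo n <= ell n 0 - ell n (m%:R * d) <= up n].
Proof.
elim: m => [|m [lo [up [loc upc H]]]].
  exists (fun=> 0), (fun=> 0); rewrite expr0n/= subrr addr0 !(mulr0, mul0r).
  split; try exact: cvg_cst.
  by apply: nearW => n; rewrite subrr lexx.
exists (fun n => lo n + A n (m%:R * d) (m.+1%:R * d)),
  (fun n => up n - A n (m.+1%:R * d) (m%:R * d)); split.
- rewrite [X in _ --> X](_ : _ = d ^+ 2 * (m%:R ^+ 2 - m%:R) / 2 +
    (m.+1%:R * d - m%:R * d) * (m%:R * d)); last by rewrite -natr1; field.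
  exact: cvgnD loc (increment_cvg _ _).
- rewrite [X in _ --> X](_ : _ = d ^+ 2 * (m%:R ^+ 2 + m%:R) / 2 -
    (m%:R * d - m.+1%:R * d) * (m.+1%:R * d)); last by rewrite -natr1; field.
  exact: cvgnB upc (increment_cvg _ _).
have B1 := increment_le (m%:R * d) (m.+1%:R * d).
have B2 := increment_le (m.+1%:R * d) (m%:R * d).
near=> n.
have /andP[h1 h2] : lo n <= ell n 0 - ell n (m%:R * d) <= up n by near: n.
have b1 : A n (m%:R * d) (m.+1%:R * d) <= ell n (m%:R * d) - ell n (m.+1%:R * d).
  by near: n.
have b2 : A n (m.+1%:R * d) (m%:R * d) <= ell n (m.+1%:R * d) - ell n (m%:R * d).
  by near: n.
by apply/andP; split; lra.
Unshelve. all: by end_near. Qed.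

Lemma drop_cvg t : ell n 0 - ell n t @[n --> \oo] --> t ^+ 2 / 2.
Proof.
apply/cvgrPdist_lt => e e0.
(* With [M.+1] steps of length [t / M.+1%:R], the limits of both bounds differ from [t ^+ 2 / 2] by
   [t ^+ 2 / 2 / M.+1%:R]. *)
have [M HM] : exists M : nat, t ^+ 2 / 2 < M.+1%:R * (e / 2).
  exists (Num.truncn (t ^+ 2 / 2 / (e / 2))).
  by rewrite -ltr_pdivrMr ?divr_gt0// truncnS_gt.
have M0 : 0 < M.+1%:R :> R by [].
have [lo [up [loc upc H]]] := drop_bounds (t / M.+1%:R) M.+1.
have dE : M.+1%:R * (t / M.+1%:R) = t by rewrite mulrCA divff ?mulr1// gt_eqF.
rewrite dE in H.
have err : t ^+ 2 / 2 / M.+1%:R < e / 2 by rewrite ltr_pdivrMr// [ltRHS]mulrC.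
have loE (x z : R) : 0 < z -> (x / z) ^+ 2 * (z ^+ 2 - z) / 2 = x ^+ 2 / 2 - x ^+ 2 / 2 / z.
  by move=> z0; field; rewrite gt_eqF.
have upE (x z : R) : 0 < z -> (x / z) ^+ 2 * (z ^+ 2 + z) / 2 = x ^+ 2 / 2 + x ^+ 2 / 2 / z.
  by move=> z0; field; rewrite gt_eqF.
rewrite (loE _ _ M0) in loc; rewrite (upE _ _ M0) in upc.
have L : \forall n \near \oo, t ^+ 2 / 2 - e < lo n.
  apply: (cvgr_gt _ loc); rewrite ltrD2l ltrN2; apply: (lt_trans err).
  by rewrite ltr_pdivrMr// ltr_pMr// ltr1n.
have U : \forall n \near \oo, up n < t ^+ 2 / 2 + e.
  apply: (cvgr_lt _ upc); rewrite ltrD2l; apply: (lt_trans err).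
  by rewrite ltr_pdivrMr// ltr_pMr// ltr1n.
near=> n.
have l1 : t ^+ 2 / 2 - e < lo n by near: n.
have u1 : up n < t ^+ 2 / 2 + e by near: n.
have /andP[h1 h2] : lo n <= ell n 0 - ell n t <= up n by near: n.
by rewrite ltr_norml; apply/andP; split; lra.
Unshelve. all: by end_near. Qed.

Definition prof n t := p n (idx n t) / p n (idx n 0).

Lemma prof_cvg t : prof n t @[n --> \oo] --> expR (- (t ^+ 2 / 2)).
Proof.
have H : expR (- (ell n 0 - ell n t)) @[n --> \oo] --> expR (- (t ^+ 2 / 2)).
  apply: continuous_cvg; first exact: continuous_expR.
  by apply: cvgN; exact: drop_cvg.
apply: cvgn_eq_near H; near=> n.
have /andP[s1 s2] : (0 < idx n 0 < n)%N by near: n; exact: near_idx.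
have /andP[t1 t2] : (0 < idx n t < n)%N by near: n; exact: near_idx.
have ps : 0 < p n (idx n 0) by rewrite p_gt0// s1 ltnW.
have pt : 0 < p n (idx n t) by rewrite p_gt0// t1 ltnW.
by rewrite opprB expRB /ell !lnK.
Unshelve. all: by end_near. Qed.

Lemma idx_bounds n t : 0 <= loc n t -> loc n t - 1 < (idx n t)%:R <= loc n t.
Proof.
by move=> /truncn_itv; rewrite -/(idx n t) -natr1 => /andP[-> ?]; rewrite andbT; lra.
Qed.

(** The tangents at [1] and [-1] serve for [t >= 0] and [t < 0]. Their scaled slopes have absolute
    value between [1 / 2] and [2] eventually; truncation costs less than one unit of [t] once
    [1 <= s]. Beyond distance [2] the slope [1 / 2] gives the decay; closer in, the slope [2] gives
    an exponent at most [4], which [expR 5] absorbs. *)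
Lemma prof_le : \forall n \near \oo, forall t, prof n t <= expR 5 * expR (- (`|t| / 2)).
Proof.
have P1 : \forall n \near \oo, prof n 1 < 1.
  by apply: (cvgr_lt _ (prof_cvg 1)); rewrite expR_lt1; lra.
have PN1 : \forall n \near \oo, prof n (-1) < 1.
  by apply: (cvgr_lt _ (prof_cvg (-1))); rewrite expR_lt1; nra.
have Y1 : \forall n \near \oo, 1/2 < sg * Num.sqrt n%:R * y n 1.
  by apply: (cvgr_gt _ (slope_cvg 1)); lra.
have Y1' : \forall n \near \oo, sg * Num.sqrt n%:R * y n 1 < 2.
  by apply: (cvgr_lt _ (slope_cvg 1)); lra.
have YN1 : \forall n \near \oo, sg * Num.sqrt n%:R * y n (-1) < - (1/2).
  by apply: (cvgr_lt _ (slope_cvg (-1))); lra.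
have YN1' : \forall n \near \oo, -2 < sg * Num.sqrt n%:R * y n (-1).
  by apply: (cvgr_gt _ (slope_cvg (-1))); lra.
have S1 : \forall n \near \oo, sg^-1 <= Num.sqrt n%:R.
  by have /cvgryPge := @cvgn_sqrt_pinfty R; apply.
near=> n => t; have n0 : (0 < n)%N by near: n; exists 1%N.
have /andP[z1 z2] : (0 < idx n 0 < n)%N by near: n; exact: near_idx.
have /andP[a1 a2] : (0 < idx n 1 < n)%N by near: n; exact: near_idx.
have /andP[b1 b2] : (0 < idx n (-1) < n)%N by near: n; exact: near_idx.
have pz : 0 < p n (idx n 0) by rewrite p_gt0// z1 ltnW.
have pa : 0 < p n (idx n 1) by rewrite p_gt0// a1 ltnW.
have pa' : 0 < p n (idx n 1).+1 by rewrite p_gt0.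
have pb : 0 < p n (idx n (-1)) by rewrite p_gt0// b1 ltnW.
have pb' : 0 < p n (idx n (-1)).+1 by rewrite p_gt0.
have la : 0 <= loc n 1 by near: n; exact: near_loc_ge0.
have lb : 0 <= loc n (-1) by near: n; exact: near_loc_ge0.
have s1 : 1 <= sg * Num.sqrt n%:R by rewrite -ler_pdivrMl// mulr1; near: n.
have q1 : prof n 1 < 1 by near: n.
have qN1 : prof n (-1) < 1 by near: n.
have y1 : 1/2 < sg * Num.sqrt n%:R * y n 1 by near: n.
have y2 : sg * Num.sqrt n%:R * y n 1 < 2 by near: n.
have z1' : sg * Num.sqrt n%:R * y n (-1) < - (1/2) by near: n.
have z2' : -2 < sg * Num.sqrt n%:R * y n (-1) by near: n.
set s := sg * Num.sqrt n%:R in s1 y1 y2 z1' z2' *.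
have s0 : 0 < s by lra.
have tangent (k : nat) : 0 < p n k -> 0 < p n k.+1 -> p n k / p n (idx n 0) < 1 ->
    - (((idx n t)%:R - k%:R) * ln (p n k / p n k.+1)) <= 5 - `|t| / 2 ->
    prof n t <= expR 5 * expR (- (`|t| / 2)).
  move=> pk pk1 qk le5; rewrite -expRD /prof ler_pdivrMr//.
  apply: (le_trans (logconcave_tangent (idx n t) (p_lc _ n0) pk pk1)).
  move: qk; rewrite ltr_pdivrMr// mul1r => qk; rewrite mulrC ler_pM ?expR_ge0 ?(ltW pk) ?(ltW qk)//.
  by rewrite ler_expR.
have [lt0|lt0] := ltP (loc n t) 0.
  have -> : prof n t = 0.
    rewrite /prof (_ : idx n t = 0%N) ?p_n0 ?mul0r//.
    by apply/truncn0Pn; rewrite -ltNge (lt_trans lt0).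
  by rewrite mulr_ge0 ?expR_ge0.
have /andP[it1 it2] := idx_bounds _ _ lt0.
have [t0|t0] := leP 0 t.
  apply: (tangent (idx n 1)) => //.
  have /andP[i1 i2] := idx_bounds _ _ la.
  rewrite ger0_norm//.
  have dE : (idx n t)%:R - (idx n 1)%:R >= s * (t - 2) by move: it1 i2; rewrite /loc -/s; nra.
  rewrite -/(y n 1).
  have y0 : 0 < y n 1 by rewrite -(pmulr_rgt0 _ s0); lra.
  have := ler_wpM2r (ltW y0) dE; rewrite mulrAC.
  have [t2|t2] := leP 2 t; nra.
apply: (tangent (idx n (-1))) => //.
have /andP[i1 i2] := idx_bounds _ _ lb.
rewrite ltr0_norm//.
have dE : (idx n t)%:R - (idx n (-1))%:R <= s * (t + 2) by move: it2 i1; rewrite /loc -/s; nra.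
rewrite -/(y n (-1)).
have y0 : y n (-1) < 0 by rewrite -(pmulr_rlt0 _ s0); lra.
have := ler_wnM2r (ltW y0) dE; rewrite mulrAC.
have [t2|t2] := leP t (-2); nra.
Unshelve. all: by end_near. Qed.

(** * Step functions and their integrals *)

Let s n : R := sg * Num.sqrt n%:R.
Let cell n k : set R := `[(k%:R - mu * n%:R) / s n, (k.+1%:R - mu * n%:R) / s n[%classic.

Let s_gt0 n : (0 < n)%N -> 0 < s n.
Proof. by move=> n0; rewrite mulr_gt0// sqrtn_gt0. Qed.

Lemma cellP n k t : (0 < n)%N -> cell n k t <-> k%:R <= loc n t < k.+1%:R.
Proof.
move=> /s_gt0 s0; rewrite /cell /= in_itv/= ler_pdivrMr// ltr_pdivlMr//.
by rewrite lerBlDl ltrBrDl.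
Qed.

Lemma step_functionE n t : (0 < n)%N ->
  p n (idx n t) = \sum_(0 <= k < n.+1) p n k * \1_(cell n k) t.
Proof.
move=> n0; have [t0|t0] := ltP (loc n t) 0.
  rewrite (_ : idx n t = 0%N); last first.
    by apply/truncn0Pn; rewrite -ltNge (lt_trans t0).
  rewrite p_n0// big1// => k _; rewrite indicE memNset ?mulr0// => /(cellP _ _ _ n0)/andP[+ _].
  by rewrite leNgt (lt_le_trans t0).
have E k : \1_(cell n k) t = (k == idx n t)%:R :> R.
  rewrite indicE eq_sym /idx truncn_eq//; congr ((_ : bool)%:R).
  by apply/idP/idP => [/set_mem/(cellP _ _ _ n0)|/(cellP _ _ _ n0)/mem_set].
under eq_bigr do rewrite E.
have [ln|nl] := leqP (idx n t) n.
  rewrite (bigD1_seq (idx n t)) ?mem_index_iota ?iota_uniq//= eqxx mulr1 big1 ?addr0//.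
  by move=> k /negPf ->; rewrite mulr0.
rewrite p_gt// big_nat big1// => k /andP[_ kn].
by rewrite (_ : _ == _ = false) ?mulr0//; apply/negbTE; rewrite neq_ltn (leq_ltn_trans _ nl).
Qed.

Let c : R := normal_peak 1.
Let c_gt0 : 0 < c. Proof. by rewrite normal_peak_gt0// oner_eq0. Qed.

(** The factor [c] makes the pointwise limit the standard normal density. *)
Let f n t : R := c * prof n t.

Let fE n t : (0 < n)%N ->
  f n t = \sum_(0 <= k < n.+1) c * p n k / p n (idx n 0) * \1_(cell n k) t.
Proof.
move=> n0; rewrite /f /prof step_functionE// mulr_suml mulr_sumr.
by apply: eq_bigr => k _; ring.
Qed.

Let coef_ge0 n k : (0 < n)%N -> 0 <= c * p n k / p n (idx n 0).
Proof. by move=> n0; rewrite divr_ge0 ?mulr_ge0 ?p_ge0// ltW. Qed.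

Let mcell n k : measurable (cell n k). Proof. exact: measurable_itv. Qed.

Let mf n (D : set R) : (0 < n)%N -> measurable_fun D (f n).
Proof.
move=> n0; rewrite (_ : f n = fun t =>
  \sum_(0 <= k < n.+1) c * p n k / p n (idx n 0) * \1_(cell n k) t).
  apply: measurable_sum => k; apply: measurable_funM => //.
by apply/funext => t; exact: fE.
Qed.

Let integral_f n (D : set R) : (0 < n)%N -> measurable D ->
  (\int[lebesgue_measure]_(t in D) (f n t)%:E =
   \sum_(0 <= k < n.+1) (c * p n k / p n (idx n 0))%:E *
     lebesgue_measure (cell n k `&` D))%E.
Proof.
move=> n0 mD; under eq_integral do rewrite fE//.
by rewrite integral_step_function// => k; exact: coef_ge0.
Qed.

Let integral_f_cvg (D : set R) : measurable D ->
  (\int[lebesgue_measure]_(t in D) (f n t)%:E @[n --> \oo] --> normal_prob 0 1 D)%E.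
Proof.
(* Dominated convergence wants the bound at every index, so the sequence is shifted to where
   [prof_le] holds and [n] is positive. *)
move=> mD; have [N0 _ HN0] := prof_le; pose N := maxn 1 N0.
have HN n t : prof (n + N) t <= expR 5 * expR (- (`|t| / 2)).
  by apply: HN0; rewrite /= /N; lia.
have nN n : (0 < n + N)%N by rewrite /N; lia.
rewrite -(cvg_shiftn N).
have [] := @dominated_convergence _ _ R lebesgue_measure D mD
  (fun n t => (f (n + N) t)%:E) (fun t => (normal_pdf 0 1 t)%:E)
  (fun t => ((c * expR 5)%:E * (expR (- (`|t| / 2)))%:E)%E).
- by move=> n; apply/measurable_EFinP; exact: mf.
- by apply/measurable_EFinP; apply: measurable_funTS; exact: measurable_normal_pdf.
- apply: aeW => t _; apply: cvg_EFin; first by apply: nearW.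
  rewrite normal_pdfE ?oner_eq0// /normal_fun subr0 expr1n.
  have -> : - t ^+ 2 / (1 *+ 2) = - (t ^+ 2 / 2) by rewrite mulNr.
  have H : f n t @[n --> \oo] --> c * expR (- (t ^+ 2 / 2)).
    by apply: cvgnM; [exact: cvg_cst|exact: prof_cvg].
  by move: H; rewrite -(cvg_shiftn N); exact.
- apply: integrableZl => //; apply: integrableS (integrable_expR_abs R) => //.
- apply: aeW => t n _; rewrite -EFinM lee_fin ger0_norm; last first.
    by rewrite /f mulr_ge0 ?(ltW c_gt0)// divr_ge0 ?p_ge0.
  by rewrite /f -mulrA ler_wpM2l ?(ltW c_gt0).
by [].
Qed.

Hypothesis p_sum : forall n, (0 < n)%N -> \sum_(0 <= k < n.+1) p n k = 1.

Let measure_cell n k : (0 < n)%N -> lebesgue_measure (cell n k) = ((s n)^-1)%:E.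
Proof.
move=> n0; have s0 := s_gt0 n n0.
rewrite /cell lebesgue_measure_itv/= lte_fin ltr_pM2r ?invr_gt0// ltrD2r ltr_nat ltnSn.
by rewrite -EFinB -mulrBl -natr1 opprB addrA subrK addrAC subrr add0r div1r.
Qed.

Section Tail.
Variable x : R.
Let D : set R := `]-oo, x]%classic.
Let mD : measurable D. Proof. exact: measurable_itv. Qed.

(* The cell containing [x] is only partly in [D], whence the error term
   [\1_(cell n k) x] in [lam_ge]. *)
Let lam n k : R := fine (lebesgue_measure (cell n k `&` D)).

Let measure_cellI n k : (0 < n)%N -> lebesgue_measure (cell n k `&` D) = (lam n k)%:E.
Proof.
move=> n0; rewrite /lam fineK// ge0_fin_numE//.
apply: (@le_lt_trans _ _ (lebesgue_measure (cell n k))).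
  apply: le_measure; rewrite ?inE; [|exact: mcell|exact: subIsetl].
  by apply: measurableI; [exact: mcell|exact: mD].
by rewrite measure_cell// ltry.
Qed.

Let lam_le n k : (0 < n)%N -> lam n k * s n <= (k%:R <= loc n x)%R%:R.
Proof.
move=> n0; have s0 := s_gt0 n n0; have [kx|xk] := leP (k%:R : R) (loc n x).
  rewrite -ler_pdivlMr// div1r -lee_fin -measure_cellI// -(measure_cell n k n0).
  apply: le_measure; rewrite ?inE; [|exact: mcell|exact: subIsetl].
  by apply: measurableI; [exact: mcell|exact: mD].
rewrite /lam (_ : _ `&` _ = set0) ?measure0 ?mul0r//.
apply/seteqP; split => // t [/(cellP _ _ _ n0)/andP[kt _]]; rewrite /D /= in_itv/= => tx.
have : loc n t <= loc n x by rewrite /loc lerD2l ler_pM2r.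
by move=> /(le_trans kt); rewrite leNgt xk.
Qed.

Let lam_ge n k : (0 < n)%N -> (k%:R <= loc n x)%R%:R - \1_(cell n k) x <= lam n k * s n.
Proof.
move=> n0; have s0 := s_gt0 n n0.
have l0 : 0 <= lam n k * s n by rewrite mulr_ge0 ?(ltW s0)// fine_ge0.
have [kx|xk] := leP (k%:R : R) (loc n x); last by rewrite (le_trans _ l0)// sub0r oppr_le0.
have [xk1|k1x] := ltP (loc n x) k.+1%:R.
  by rewrite indicE mem_set ?subrr//; apply/(cellP _ _ _ n0); rewrite kx xk1.
rewrite lerBlDr ler_wpDr// -ler_pdivrMr// div1r -lee_fin -measure_cellI// -(measure_cell n k n0).
rewrite (_ : cell n k `&` D = cell n k)//; apply/seteqP; split; first exact: subIsetl.
move=> t kt; split=> //; move: kt => /(cellP _ _ _ n0)/andP[_ tk].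
rewrite /D /= in_itv/=.
have : loc n t <= loc n x by rewrite (le_trans (ltW tk)).
by rewrite /loc lerD2l ler_pM2r.
Qed.

(** By [p_sum], dividing the integral of [f n] over [D] by its integral [a n] over the line cancels
    the unknown peak [p n (idx n 0)]. The quotient is the partial sum up to the mass [p n (idx n x)]
    of the boundary cell, which tends to [0] like [(s n)^-1]. *)
Lemma local_to_global :
  \sum_(0 <= k < n.+1 | k%:R <= loc n x) p n k @[n --> \oo] -->
  fine (normal_prob 0 1 `]-oo, x]%classic).
Proof.
pose a n := fine (\int[lebesgue_measure]_(t in [set: R]) (f n t)%:E)%E.
pose B n := fine (\int[lebesgue_measure]_(t in D) (f n t)%:E)%E.
pose F n := \sum_(0 <= k < n.+1 | k%:R <= loc n x) p n k.
have a1 : a n @[n --> \oo] --> (1 : R).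
  apply: fine_cvg; rewrite -[X in _ --> X](probability_setT (normal_prob 0 1)).
  exact: integral_f_cvg.
have BD : B n @[n --> \oo] --> fine (normal_prob 0 1 D).
  apply: fine_cvg; rewrite fineK; first exact: integral_f_cvg.
  exact: fin_num_measure.
have A0 : \forall n \near \oo, 0 < a n by exact: cvgr_gt a1 _ ltr01.
have sV : (s n)^-1 @[n --> \oo] --> (0 : R).
  rewrite [X in _ --> X](_ : 0 = sg^-1 * 0); last by rewrite mulr0.
  apply: cvgn_eq_near (cvgnM (cvg_cst sg^-1) (@cvgn_sqrtV R)).
  by apply: nearW => n; rewrite /s invfM.
have fx : f n x @[n --> \oo] --> c * expR (- (x ^+ 2 / 2)).
  by apply: cvgnM; [exact: cvg_cst|exact: prof_cvg].
have AV : (a n)^-1 @[n --> \oo] --> (1 : R).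
  rewrite -[X in _ --> X]invr1; apply: cvgV => //; exact: oner_neq0.
have err : f n x * (a n)^-1 * (s n)^-1 @[n --> \oo] --> (0 : R).
  rewrite [X in _ --> X](_ : 0 = c * expR (- (x ^+ 2 / 2)) * 1 * 0); last by rewrite mulr0.
  by do 2?apply: cvgnM.
have J : B n * (a n)^-1 @[n --> \oo] --> fine (normal_prob 0 1 D).
  by rewrite -[X in _ --> X]mulr1; apply: cvgnM.
have hi : B n * (a n)^-1 + f n x * (a n)^-1 * (s n)^-1 @[n --> \oo] -->
    fine (normal_prob 0 1 D).
  by rewrite -[X in _ --> X]addr0; apply: cvgnD.
apply: squeeze_cvgr J hi; near=> n.
have n0 : (0 < n)%N by near: n; exists 1%N.
have an : 0 < a n by near: n.
have s0 := s_gt0 n n0.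
have /andP[z1 z2] : (0 < idx n 0 < n)%N by near: n; exact: near_idx.
have p0 : 0 < p n (idx n 0) by rewrite p_gt0// z1 ltnW.
have AE : a n = c / p n (idx n 0) / s n.
  rewrite /a integral_f//.
  under eq_bigr do rewrite setIT measure_cell// -EFinM.
  rewrite sumEFin /=; under eq_bigr do rewrite -!mulrA.
  by rewrite -mulr_sumr -mulr_suml p_sum// mul1r mulrA.
have BE : B n * (a n)^-1 = \sum_(0 <= k < n.+1) p n k * (lam n k * s n).
  rewrite /B integral_f//.
  under eq_bigr do rewrite measure_cellI// -EFinM.
  rewrite sumEFin /= mulr_suml; apply: eq_bigr => k _.
  by rewrite AE; field; rewrite ?(gt_eqF s0) ?(gt_eqF p0) ?(gt_eqF c_gt0).
have fE' : f n x * (a n)^-1 * (s n)^-1 = p n (idx n x).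
  by rewrite /f /prof AE; field; rewrite ?(gt_eqF s0) ?(gt_eqF p0) ?(gt_eqF c_gt0).
have FE : F n = \sum_(0 <= k < n.+1) p n k * (k%:R <= loc n x)%R%:R.
  by rewrite /F big_mkcond; apply: eq_bigr => k _; case: ifP; rewrite ?mulr1 ?mulr0.
rewrite -/(F n) fE' BE step_functionE// FE -big_split /=; apply/andP; split.
  by apply: ler_sum => k _; rewrite ler_wpM2l ?p_ge0// lam_le.
apply: ler_sum => k _; rewrite -mulrDr ler_wpM2l ?p_ge0// -lerBlDr.
exact: lam_ge.
Unshelve. all: by end_near. Qed.

End Tail.

End LocalLimit.

Set Implicit Arguments.

(** * Convergence in distribution *)

Section DiscreteCdf.
Context (R : realType) (d : measure_display) (T : measurableType d)
  (P : probability T R) (X : {RV P >-> R}) (n : nat) (p : nat -> R).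
Hypothesis Xp : has_pmf_on X n p.
Hypothesis p0 : p 0%N = 0.
Hypothesis p_sum : \sum_(0 <= k < n.+1) p k = 1.

Let atom (k : nat) : set T := X @^-1` [set k%:R].

Let measurable_atom k : measurable (atom k).
Proof. by apply: measurable_funPTI => //; exact: measurable_set1. Qed.

Let prob_atom k : (1 <= k <= n)%N -> P (atom k) = (p k)%:E.
Proof. by move=> kn; rewrite -(Xp kn) /pmf fineK// fin_num_measure. Qed.

(** A lower bound suffices: applied to an event and to its complement it forces equality, as the
    masses [p k] add up to [1]. *)
Let prob_ge (q : pred nat) (E : set T) : measurable E ->
  (forall k, q k -> atom k `<=` E) ->
  ((\sum_(0 <= k < n.+1 | q k) p k)%:E <= P E)%E.
Proof.
(* The atom at [0] is replaced by the empty set, since [has_pmf_on] does not speak about it and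
   [p 0 = 0]. *)
move=> mE qE; pose F k := if (0 < k)%N && q k then atom k else set0.
have mF k : measurable (F k) by rewrite /F; case: ifP.
have tF : trivIset setT F.
  move=> i j _ _ [t []]; rewrite /F; case: ifP => // _; case: ifP => // _.
  by rewrite /atom /= => -> /eqP; rewrite eqr_nat => /eqP.
have FE : (\sum_(0 <= k < n.+1 | q k) p k)%:E = P (\big[setU/set0]_(i < n.+1) F i).
  rewrite measure_bigsetU// big_mkcond big_mkord -sumEFin; apply: eq_bigr => -[i /= iN] _.
  rewrite /F; case: i iN => [_|i iN] /=; first by rewrite p0 measure0; case: ifP.
  by case: ifP => qi; rewrite ?measure0 ?prob_atom.
rewrite FE; apply: le_measure; rewrite ?inE//; first exact: bigsetU_measurable.
rewrite -bigcup_mkord => t [i _]; rewrite /F; case: ifP => // /andP[_ qi].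
exact: qE.
Qed.

Lemma cdf_standardize (m s x : R) : 0 < s ->
  cdf (standardize X m s) x = (\sum_(0 <= k < n.+1 | k%:R <= m + x * s) p k)%:E.
Proof.
move=> s0; set q := fun k : nat => k%:R <= m + x * s.
pose E := X @^-1` `]-oo, m + x * s].
have mE : measurable E by apply: measurable_funPTI => //; exact: measurable_itv.
have -> : cdf (standardize X m s) x = P E.
  rewrite /cdf /distribution /pushforward; congr (P _); apply/seteqP.
  by split => t /=; rewrite !in_itv/= ler_pdivrMr// lerBlDl.
apply/eqP; rewrite eq_le; apply/andP; split; last first.
  by apply: prob_ge => // k qk t; rewrite /atom /E /= in_itv/= => ->.
have : ((\sum_(0 <= k < n.+1 | ~~ q k) p k)%:E <= P (~` E))%E.
  apply: prob_ge; first exact: measurableC.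
  by move=> k qk t; rewrite /atom /E /= in_itv/= => -> h; move: qk; rewrite /q h.
have := p_sum; rewrite (bigID q) /= => qq.
have -> : \sum_(0 <= k < n.+1 | ~~ q k) p k = 1 - \sum_(0 <= k < n.+1 | q k) p k.
  by rewrite -qq addrC addrK.
rewrite probability_setC// -[P E]fineK ?fin_num_measure// !lee_fin; lra.
Qed.

End DiscreteCdf.

Lemma clt_of_ratio (R : realType) (d : nat -> measure_display)
    (T : forall n, measurableType (d n)) (P : forall n, probability (T n) R)
    (X : forall n, {RV (P n) >-> R}) (p : nat -> nat -> R) (mu v : R) :
  (forall n, (0 < n)%N -> has_pmf_on (X n) n (p n)) ->
  (forall n, (0 < n)%N -> p n 0 = 0) ->
  (forall n k, (n < k)%N -> p n k = 0) ->
  (forall n k, (0 < k <= n)%N -> 0 < p n k) ->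
  (forall n, (0 < n)%N -> logconcave (p n)) ->
  (forall n, (0 < n)%N -> \sum_(0 <= k < n.+1) p n k = 1) ->
  0 < mu < 1 -> 0 < v ->
  (forall (k : nat -> nat) (a : R), dcvg (fun n => (k n)%:R / n%:R) mu a ->
    Num.sqrt n%:R * ln (p n (k n) / p n (k n).+1) @[n --> \oo] --> a / v) ->
  cvg_in_distribution
    (fun n => standardize (X n) (mu * n%:R) (Num.sqrt v * Num.sqrt n%:R))
    (normal_prob 0 1).
Proof.
move=> Xp p0 pgt pgt0 plc psum mu01 v0 ratio x _.
have s0 : 0 < Num.sqrt v by rewrite sqrtr_gt0.
have vE : v = Num.sqrt v ^+ 2 by rewrite sqr_sqrtr// ltW.
rewrite vE in ratio.
have := local_to_global R p mu (Num.sqrt v) p0 pgt pgt0 plc mu01 s0 ratio psum x.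
rewrite -[X in _ -> _ --> X]fineK ?fin_num_measure//.
set l := fine _ => H.
have H' : (\sum_(0 <= k < n.+1 | k%:R <= mu * n%:R + x * (Num.sqrt v * Num.sqrt n%:R)) p n k)%:E
    @[n --> \oo] --> l%:E.
  by apply: cvg_EFin; [exact: nearW|exact: H].
apply: cvg_trans H'; apply: near_eq_cvg; near=> n.
have n0 : (0 < n)%N by near: n; exists 1%N.
by rewrite (cdf_standardize (Xp n n0) (p0 n n0) (psum n n0))// mulr_gt0// sqrtn_gt0.
Unshelve. all: by end_near. Qed.

(** * The three laws *)

Section Laws.
Variable R : realType.
Implicit Types (n k : nat) (theta vt : R).

(** The weight is controlled only up to [n], since falling factorials may become negative later;
    there [a] vanishes. *)
Lemma logconcaveM (a w : nat -> R) n : (forall k, 0 <= a k) -> logconcave a ->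
  (forall k, (n < k)%N -> a k = 0) ->
  (forall k, (k <= n)%N -> 0 <= w k) ->
  (forall i j, (i <= j < n)%N -> w i * w j.+1 <= w i.+1 * w j) ->
  logconcave (fun k => a k * w k).
Proof.
move=> a0 lca agt w0 lcw i j ij.
have aw0 k : 0 <= a k * w k.
  have [kn|nk] := leqP k n; first by rewrite mulr_ge0 ?w0.
  by rewrite agt// mul0r.
have [jn|nj] := ltnP j n; last by rewrite (agt j.+1)// mul0r mulr0 mulr_ge0.
rewrite mulrACA [leRHS]mulrACA ler_pM ?mulr_ge0 ?lca ?lcw ?ij ?w0//; lia.
Qed.

Lemma stirling1_poly_gt0 n theta : (0 < n)%N -> 0 < theta -> 0 < stirling1_poly n theta.
Proof.
move=> n0 t0; rewrite /stirling1_poly big_ltn//= ltr_pwDl//.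
  by rewrite mulr_gt0 ?exprn_gt0// ltr0n stirling1_gt0.
by rewrite sumr_ge0// => k _; rewrite mulr_ge0 ?exprn_ge0// ltW.
Qed.

Lemma stirling2_poly_gt0 n theta : (0 < n)%N -> 0 < theta -> 0 < stirling2_poly n theta.
Proof.
move=> n0 t0; rewrite /stirling2_poly big_ltn//= ltr_pwDl//.
  by rewrite mulr_gt0 ?exprn_gt0// ltr0n stirling2_gt0.
by rewrite sumr_ge0// => k _; rewrite mulr_ge0 ?exprn_ge0// ltW.
Qed.

Lemma ffactrS theta k : ffactr theta k.+1 = ffactr theta k * (theta - k%:R).
Proof. by rewrite /ffactr big_ord_recr. Qed.

Lemma ffactr_gt0 theta n k : n%:R <= theta -> (k <= n)%N -> 0 < ffactr theta k.
Proof.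
move=> nt kn; rewrite /ffactr prodr_gt0// => j _.
by rewrite subr_gt0 (lt_le_trans _ nt)// ltr_nat (leq_trans (ltn_ord j)).
Qed.

(** The normalization of the third law. Splitting [theta = k%:R + (theta - k%:R)] in the term of
    index [k] reproduces the two terms of [stirling2S]. *)
Lemma sum_stirling2_ffactr n theta :
  \sum_(0 <= k < n.+1) (stirling2 n k)%:R * ffactr theta k = theta ^+ n.
Proof.
elim: n => [|n IHn].
  by rewrite big_nat1 stirling2_0 /ffactr big_ord0 expr0 mulr1.
under eq_bigr do rewrite stirling2S natrD !natrM mulrDl.
rewrite big_split /= big_nat_recr//= stirling2_gt_eq0// mulr0 mul0r addr0.
rewrite [X in _ + X]big_nat_recl//= !mul0r add0r -big_split /= exprS -IHn mulr_sumr.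
by apply: eq_bigr => k _; rewrite mulr1n mul1r ffactrS; ring.
Qed.

Lemma near_pmf_ratio (k : nat -> nat) (p q : nat -> nat -> R) (c a l : R) : 0 < c < 1 ->
  dcvg (fun n => (k n)%:R / n%:R) c a ->
  (forall n, (0 < k n < n)%N -> q n (k n) = p n (k n) / p n (k n).+1) ->
  Num.sqrt n%:R * ln (q n (k n)) @[n --> \oo] --> l ->
  Num.sqrt n%:R * ln (p n (k n) / p n (k n).+1) @[n --> \oo] --> l.
Proof.
move=> c01 kc pq H; apply: cvgn_eq_near H; have := near_natr_itv c01 kc.
by apply: filterS => n kn; rewrite pq.
Qed.

End Laws.

Theorem corollary2p10 (R : realType) (d : nat -> measure_display)
    (T : forall n : nat, measurableType (d n))
    (P : forall n : nat, probability (T n) R)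
    (X : forall n : nat, {RV (P n) >-> R}) (vartheta : R) :
  [/\ 0 < vartheta ->
      (forall n : nat, (0 < n)%N ->
         has_pmf_on (X n) n (pmf1 n (vartheta * n%:R))) ->
      cvg_in_distribution
        (fun n => standardize (X n) (mu1 vartheta * n%:R)
                    (sigma1 vartheta * Num.sqrt n%:R))
        (normal_prob 0 1),
      0 < vartheta ->
      (forall n : nat, (0 < n)%N ->
         has_pmf_on (X n) n (pmf2 n (vartheta * n%:R))) ->
      cvg_in_distribution
        (fun n => standardize (X n) (mu2 vartheta * n%:R)
                    (sigma2 vartheta * Num.sqrt n%:R))
        (normal_prob 0 1)
    & 1 <= vartheta ->
      (forall n : nat, (0 < n)%N ->
         has_pmf_on (X n) n (pmf3 n (vartheta * n%:R))) ->
      cvg_in_distribution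
        (fun n => standardize (X n) (mu3 vartheta * n%:R)
                    (sigma3 vartheta * Num.sqrt n%:R))
        (normal_prob 0 1)].
Proof.
have theta0 n : 0 < vartheta -> (0 < n)%N -> 0 < vartheta * n%:R.
  by move=> t0 n0; rewrite mulr_gt0// ltr0n.
split=> [t0|t0|t1] Xp.
- have Z0 n (n0 : (0 < n)%N) := stirling1_poly_gt0 n0 (theta0 n t0 n0).
  apply: (clt_of_ratio Xp) => [n n0|n k nk|n k kn|n n0|n n0|||k a ka].
  + by rewrite /pmf1; case: n n0 => // n _; rewrite stirling1_n0 !mul0r.
  + by rewrite /pmf1 stirling1_gt_eq0// !mul0r.
  + have n0 : (0 < n)%N by lia.
    by rewrite /pmf1 divr_gt0 ?Z0// mulr_gt0 ?exprn_gt0 ?theta0// ltr0n stirling1_gt0.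
  + pose w k : R := (vartheta * n%:R) ^+ k / stirling1_poly n (vartheta * n%:R).
    have E k : pmf1 n (vartheta * n%:R) k = (stirling1 n k)%:R * w k by rewrite /pmf1 /w mulrA.
    suff H : logconcave (fun k => (stirling1 n k)%:R * w k) by move=> i j; rewrite !E; exact: H.
    apply: (logconcaveM (n := n)) => //.
    * exact: logconcave_stirling1.
    * by move=> k nk; rewrite stirling1_gt_eq0.
    * by move=> k _; rewrite /w divr_ge0 ?exprn_ge0 ?ltW ?theta0 ?Z0.
    (* Geometric weights give equality. *)
    * by move=> i j _; rewrite /w !exprS le_eqVlt; apply/orP; left; apply/eqP; ring.
  + rewrite big_ltn//= {1}/pmf1; case: n n0 => // n _; rewrite stirling1_n0 !mul0r add0r.
    by rewrite -mulr_suml divff// gt_eqF// Z0.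
  + by rewrite mu1_gt0// mu1_lt1.
  + exact: var1_gt0.
  have m01 : 0 < mu1 vartheta < 1 by rewrite mu1_gt0// mu1_lt1.
  apply: (near_pmf_ratio (p := fun n => pmf1 n (vartheta * n%:R)) (q := fun n k => (stirling1 n k)%:R / (stirling1 n k.+1)%:R /
    (vartheta * n%:R)) m01 ka _ (stirling1_ratio_cvg t0 ka)).
  move=> n kn; have n0 : (0 < n)%N by lia.
  have s1 : 0 < (stirling1 n (k n).+1)%:R :> R by rewrite ltr0n stirling1_gt0//; lia.
  rewrite /pmf1 exprS; field.
  by rewrite ?(gt_eqF s1) ?expf_neq0 ?(gt_eqF (theta0 n t0 n0)) ?(gt_eqF (Z0 n n0)) ?gt_eqF ?ltr0n.
- have Z0 n (n0 : (0 < n)%N) := stirling2_poly_gt0 n0 (theta0 n t0 n0).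
  apply: (clt_of_ratio Xp) => [n n0|n k nk|n k kn|n n0|n n0|||k a ka].
  + by rewrite /pmf2; case: n n0 => // n _; rewrite stirling2_n0 !mul0r.
  + by rewrite /pmf2 stirling2_gt_eq0// !mul0r.
  + have n0 : (0 < n)%N by lia.
    by rewrite /pmf2 divr_gt0 ?Z0// mulr_gt0 ?exprn_gt0 ?theta0// ltr0n stirling2_gt0.
  + pose w k : R := (vartheta * n%:R) ^+ k / stirling2_poly n (vartheta * n%:R).
    have E k : pmf2 n (vartheta * n%:R) k = (stirling2 n k)%:R * w k by rewrite /pmf2 /w mulrA.
    suff H : logconcave (fun k => (stirling2 n k)%:R * w k) by move=> i j; rewrite !E; exact: H.
    apply: (logconcaveM (n := n)) => //.
    * exact: logconcave_stirling2.
    * by move=> k nk; rewrite stirling2_gt_eq0.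
    * by move=> k _; rewrite /w divr_ge0 ?exprn_ge0 ?ltW ?theta0 ?Z0.
    * by move=> i j _; rewrite /w !exprS le_eqVlt; apply/orP; left; apply/eqP; ring.
  + rewrite big_ltn//= {1}/pmf2; case: n n0 => // n _; rewrite stirling2_n0 !mul0r add0r.
    by rewrite -mulr_suml divff// gt_eqF// Z0.
  + exact: mu2_itv.
  + exact: var2_gt0.
  apply: (near_pmf_ratio (p := fun n => pmf2 n (vartheta * n%:R)) (q := fun n k => (stirling2 n k)%:R / (stirling2 n k.+1)%:R /
    (vartheta * n%:R)) (mu2_itv t0) ka _ (stirling2_law2_ratio_cvg t0 ka)).
  move=> n kn; have n0 : (0 < n)%N by lia.
  have s1 : 0 < (stirling2 n (k n).+1)%:R :> R by rewrite ltr0n stirling2_gt0//; lia.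
  rewrite /pmf2 exprS; field.
  by rewrite ?(gt_eqF s1) ?expf_neq0 ?(gt_eqF (theta0 n t0 n0)) ?(gt_eqF (Z0 n n0)) ?gt_eqF ?ltr0n.
have t0 : 0 < vartheta by rewrite (lt_le_trans ltr01).
(* Here [1 <= vartheta] enters: it keeps the falling factorials positive up to [k = n]. *)
have nt n : n%:R <= vartheta * n%:R by rewrite ler_peMl.
apply: (clt_of_ratio Xp) => [n n0|n k nk|n k kn|n n0|n n0|||k a ka].
- by rewrite /pmf3; case: n n0 => // n _; rewrite stirling2_n0 !mul0r.
- by rewrite /pmf3 stirling2_gt_eq0// !mul0r.
- have n0 : (0 < n)%N by lia.
  rewrite /pmf3 divr_gt0 ?exprn_gt0 ?theta0// mulr_gt0 ?ltr0n ?stirling2_gt0//.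
  by apply: (ffactr_gt0 (nt n)); lia.
- pose w k : R := ffactr (vartheta * n%:R) k / (vartheta * n%:R) ^+ n.
  have E k : pmf3 n (vartheta * n%:R) k = (stirling2 n k)%:R * w k by rewrite /pmf3 /w mulrA.
  suff H : logconcave (fun k => (stirling2 n k)%:R * w k) by move=> i j; rewrite !E; exact: H.
    apply: (logconcaveM (n := n)) => //.
  + exact: logconcave_stirling2.
  + by move=> k nk; rewrite stirling2_gt_eq0.
  + move=> k kn; rewrite /w divr_ge0 ?exprn_ge0 ?ltW ?theta0//.
    exact: (ffactr_gt0 (nt n)).
  + move=> i j /andP[ij jn]; rewrite /w !ffactrS.
    have fi : 0 < ffactr (vartheta * n%:R) i by apply: (ffactr_gt0 (nt n)); lia.
    have fj : 0 < ffactr (vartheta * n%:R) j by apply: (ffactr_gt0 (nt n)); lia.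
    (* Cancelling the positive common factors leaves a comparison of the last factors of the falling
       factorials, [theta - j <= theta - i] with [theta = vartheta * n%:R]. *)
    rewrite mulrACA [leRHS]mulrACA ler_pM2r; last by rewrite mulr_gt0// invr_gt0 exprn_gt0 ?theta0.
    rewrite mulrA [leRHS]mulrAC ler_pM2l ?mulr_gt0//.
    by rewrite lerD2l lerN2 ler_nat.
- by rewrite /pmf3 -mulr_suml sum_stirling2_ffactr divff// expf_neq0// gt_eqF ?theta0.
- exact: mu3_itv.
- exact: var3_gt0.
apply: (near_pmf_ratio (p := fun n => pmf3 n (vartheta * n%:R)) (q := fun n k => (stirling2 n k)%:R / (stirling2 n k.+1)%:R /
    (vartheta * n%:R - k%:R)) (mu3_itv t0) ka _ (stirling2_law3_ratio_cvg t0 ka)).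
move=> n kn; have n0 : (0 < n)%N by lia.
have s1 : 0 < (stirling2 n (k n).+1)%:R :> R by rewrite ltr0n stirling2_gt0//; lia.
have fk : 0 < ffactr (vartheta * n%:R) (k n) by apply: (ffactr_gt0 (nt n)); lia.
have tk : 0 < vartheta * n%:R - (k n)%:R.
  by rewrite subr_gt0 (lt_le_trans _ (nt n))// ltr_nat; lia.
rewrite /pmf3 ffactrS; field.
by rewrite ?(gt_eqF s1) ?expf_neq0 ?(gt_eqF fk) ?(gt_eqF tk) ?(gt_eqF (theta0 n t0 n0)) ?gt_eqF ?ltr0n.
Qed.
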